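(* Let $Q(x,y,z)$ be an irreducible form over $\mathbb C$ of degree $l=\deg(Q)>2$, and let $\omega=\{d=\sum_{i=1}^sd_i\}$ be a partition with $d_i\ge l$ for $1\le i\le s$. Then (for $s\ge2$) the map $\Phi_\omega$ is not onto, i.e. a generic polynomial from $V_Q^\perp(d)^\circ$ is not a product of polynomials of degrees $\ge l$. The codimension of $\Phi_\omega(\mathcal M_Q(\omega))$ in $V_Q^\perp(d)$ is $\frac{s-1}{2}[l^2-3l+2]$.
   Context: $V(d)$ is the space of homogeneous complex polynomials of degree $d$ in $x,y,z$; $V_Q(d)=Q\cdot V(d-l)$ is the subspace of polynomials divisible by $Q$ (zero if $d<l$); $V_Q^\perp(d)$ is an orthogonal complement of $V_Q(d)$ in $V(d)$, identified with $V(d)/V_Q(d)$, i.e. with the homogeneous degree $d$ polynomial functions on the surface $\{Q=0\}\subset\mathbb C^3$. $V^\circ=V\setminus\{0\}$. $H_s=\{(\lambda_i)\in(\mathbb C^\ast)^s:\prod\lambda_i=1\}$ acts on $\prod_{i=1}^sV_Q^\perp(d_i)^\circ$ by rescaling the factors; $S_\omega\subset S_s$ is the subgroup of permutations $\sigma$ with $d_{\sigma(i)}=d_i$ for all $i$; $\Sigma_\omega$ is the group generated by $S_\omega$ and $H_s$. $\mathcal M_Q(\omega)=\prod_{i=1}^sV_Q^\perp(d_i)^\circ/\Sigma_\omega$. The map $\Phi_\omega:\mathcal M_Q(\omega)\to V_Q^\perp(d)^\circ$ is induced by taking the product of the polynomial functions $P_i\in V_Q^\perp(d_i)$ on the surface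 $\{Q=0\}$. *)

(* Defs.v *)
From HB Require Import structures.
From mathcomp Require Export all_boot all_order all_algebra.
From mathcomp Require Export fingroup perm mpoly complex.
From mathcomp Require Import boolp.
From mathcomp Require Export reals.

Set Implicit Arguments.
Unset Strict Implicit.
Unset Printing Implicit Defensive.

Import Order.TTheory GRing.Theory Num.Theory.

Local Open Scope ring_scope.

Definition irreducible_mpoly (n : nat) (K : fieldType) (p : {mpoly K[n]}) : Prop :=
  [/\ p != 0, p \isn't a GRing.unit &
      forall a b : {mpoly K[n]}, p = a * b ->
        a \is a GRing.unit \/ b \is a GRing.unit].

Section Zariski.
Variables (K : fieldType) (V : vectType K).

(* The polynomial function on V given by f in coordinates; the resulting
   topology does not depend on the chosen basis. *)
Definition polyfun (f : {mpoly K[\dim {:V}]}) (v : V) : K :=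
  f.@[fun i => coord (vbasis {:V}) i v].

Definition zclosed (Z : V -> Prop) : Prop :=
  exists S : {mpoly K[\dim {:V}]} -> Prop,
    forall v, Z v <-> (forall f, S f -> polyfun f v = 0).

Definition zopen (U : V -> Prop) : Prop := zclosed (fun v => ~ U v).

Definition zgeneric (P : V -> Prop) : Prop :=
  exists U : V -> Prop,
    [/\ zopen U, exists v, U v & forall v, U v -> P v].

Definition zclosed_in (X Z : V -> Prop) : Prop :=
  exists2 Y, zclosed Y & forall v, Z v <-> X v /\ Y v.

Definition zirreducible (Z : V -> Prop) : Prop :=
  (exists v, Z v) /\
  forall Y1 Y2, zclosed Y1 -> zclosed Y2 ->
    (forall v, Z v -> Y1 v \/ Y2 v) ->
    (forall v, Z v -> Y1 v) \/ (forall v, Z v -> Y2 v).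

Definition zchain (X : V -> Prop) (n : nat) (Z : nat -> V -> Prop) : Prop :=
  (forall i, (i <= n)%N -> zclosed_in X (Z i) /\ zirreducible (Z i)) /\
  (forall i, (i < n)%N ->
     (forall v, Z i v -> Z i.+1 v) /\ (exists2 v, Z i.+1 v & ~ Z i v)).

(* Krull dimension of X for the topology induced by the Zariski topology of V;
   it equals that of the Zariski closure when X is constructible. *)
Definition zdim (X : V -> Prop) (n : nat) : Prop :=
  (exists Z, zchain X n Z) /\ (forall m Z, zchain X m Z -> (m <= n)%N).

Definition zcodim (X : V -> Prop) (c : nat) : Prop :=
  exists2 n, zdim X n & (n + c = \dim {:V})%N.

End Zariski.

Section OrthogonalComplement.
Variables (C : numClosedFieldType) (U : vectType C) (form : {dot U for Num.conj}).

Lemma cap_orthov (W : {vspace U}) : (orthov form W :&: W = 0)%VS.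
Proof.
apply/eqP; rewrite -subv0; apply/subvP => p; rewrite memv_cap => /andP[po pW].
by rewrite memv0 -(dnorm_eq0 form); apply/eqP/(mem_orthovP po).
Qed.

Lemma dim_orthov_span us (W : {vspace U}) :
  (\dim W - size us <= \dim (W :&: orthov form <<us>>))%N.
Proof.
elim: us W => [|u us IH] W; first by rewrite span_nil orthov0 capvf subn0.
have -> : (W :&: orthov form <<u :: us>> =
           (W :&: orthov form <[u]>) :&: orthov form <<us>>)%VS.
  apply/vspaceP => v; rewrite span_cons !memv_cap -andbA.
  by rewrite !(mem_orthov_sym form) subv_add.
apply: leq_trans (IH _); rewrite /= subnS -subn1 subnAC leq_sub2r // subn1.
exact: leq_dim_orthov1.
Qed.

Lemma add_orthov (W : {vspace U}) : (orthov form W + W = fullv)%VS.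
Proof.
apply/eqP; rewrite eqEdim subvf /= dimv_disjoint_sum ?cap_orthov //.
have := dim_orthov_span (vbasis W) fullv.
by rewrite size_tuple capfv (span_basis (vbasisP _)) leq_subLR addnC.
Qed.

End OrthogonalComplement.

Section SurfacePolynomials.
Variable R : realType.
Local Notation C := R[i].
Local Notation V d := (dhomog 3 C d).

Variables (l : nat) (Q : V l).

(* [indhomog d p] is p itself, as an element of V d, when p is d-homogeneous. *)
Definition mulQ (d : nat) (r : V (d - l)) : V d :=
  indhomog d ((Q : {mpoly C[3]}) * (r : {mpoly C[3]})).

Definition VQ (d : nat) : {vspace V d} :=
  if (l <= d)%N then limg (linfun (@mulQ d)) else 0%VS.

Variable ip : forall d : nat, {dot V d for Num.conj}.

Definition VQorth (d : nat) : {vspace V d} := orthov (ip d) (VQ d).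

Definition VQperp (d : nat) : vectType C := subvs_of (VQorth d).

Definition poly_of (d : nat) (p : VQperp d) : {mpoly C[3]} :=
  mpoly_of_dhomog (vsval p).

(* Product of polynomial functions on {Q = 0}: the product in C[x,y,z],
   projected to the orthogonal complement along V_Q(d). Meant for
   d = \sum_i omega i. *)
Definition prod_perp (d s : nat) (omega : 'I_s -> nat)
    (P : forall i, VQperp (omega i)) : VQperp d :=
  vsproj (VQorth d)
    (daddv_pi (VQorth d) (VQ d) (indhomog d (\prod_(i < s) poly_of (P i)))).

Section Moduli.
Variables (s : nat) (omega : 'I_s -> nat).

Record factors := Factors {
  factor :> forall i, VQperp (omega i);
  factor_neq0 : forall i, factor i != 0 }.

(* Lying in the same orbit of the group generated by H_s and S_omega.
   Equality is tested on the underlying polynomials because P i and P (sg i)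
   live in types that are only propositionally equal. *)
Inductive Sigma_eq : factors -> factors -> Prop :=
| Sigma_scale (P P' : factors) (lam : 'I_s -> C) :
    (forall i, lam i != 0) -> \prod_(i < s) lam i = 1 ->
    (forall i, P' i = lam i *: P i) -> Sigma_eq P P'
| Sigma_perm (P P' : factors) (sg : 'S_s) :
    (forall i, omega (sg i) = omega i) ->
    (forall i, poly_of (P' i) = poly_of (P (sg i))) -> Sigma_eq P P'
| Sigma_trans (P P' P'' : factors) :
    Sigma_eq P P' -> Sigma_eq P' P'' -> Sigma_eq P P''.

Record moduli := Moduli {
  orbit_pred : factors -> Prop;
  orbit_predP : exists P, orbit_pred = Sigma_eq P }.

Definition moduli_class (P : factors) : moduli :=
  Moduli (ex_intro _ P (erefl (Sigma_eq P))).

(* The map induced by prod_perp, see PhiE; prod_perp has nonzero values on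
   nonzero factors since an irreducible Q is prime. *)
Definition Phi (d : nat) (m : moduli) : VQperp d :=
  prod_perp d (sval (cid (orbit_predP m))).

End Moduli.

Definition product_of_degrees_ge (d : nat) (W : VQperp d) : Prop :=
  exists (k : nat) (e : 'I_k -> nat) (P : forall i, VQperp (e i)),
    [/\ (2 <= k)%N, forall i, (l <= e i)%N, (\sum_(i < k) e i)%N = d
      & prod_perp d P = W].

Lemma poly_ofZ d (a : C) (p : VQperp d) : poly_of (a *: p) = a *: poly_of p.
Proof. by []. Qed.

Lemma Sigma_eq_prod s (omega : 'I_s -> nat) d (P P' : factors omega) :
  Sigma_eq P P' -> prod_perp d P = prod_perp d P'.
Proof.
rewrite /prod_perp => PP'.
suff -> : \prod_(i < s) poly_of (P i) = \prod_(i < s) poly_of (P' i) by [].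
elim: PP' => [A B lam _ lam1 E|A B sg _ E|A A' B _ -> _ ->] //.
  under [RHS]eq_bigr => i _ do rewrite E poly_ofZ.
  by rewrite scaler_prod lam1 scale1r.
under [RHS]eq_bigr => i _ do rewrite E.
exact: (reindex_inj (@perm_inj _ sg)).
Qed.

Lemma Sigma_eq_refl s (omega : 'I_s -> nat) (P : factors omega) : Sigma_eq P P.
Proof.
apply: (@Sigma_scale _ _ _ _ (fun=> 1)) => [i||i]; rewrite ?oner_neq0 //.
  by rewrite big1.
by rewrite scale1r.
Qed.

Lemma PhiE s (omega : 'I_s -> nat) d (P : factors omega) :
  Phi d (moduli_class P) = prod_perp d P.
Proof.
rewrite /Phi; case: cid => /= P' E.
by symmetry; apply: Sigma_eq_prod; rewrite E; apply: Sigma_eq_refl.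
Qed.

Lemma indhomogK d (p : {mpoly C[3]}) : p \is d.-homog ->
  indhomog d p = p :> {mpoly C[3]}.
Proof. exact: insubdK. Qed.

Lemma mulQE d (r : V (d - l)) : (l <= d)%N ->
  mulQ r = (Q : {mpoly C[3]}) * (r : {mpoly C[3]}) :> {mpoly C[3]}.
Proof.
move=> ld; rewrite /mulQ indhomogK // -[X in X.-homog](subnKC ld).
by apply: dhomogM; apply: dhomog_is_dhomog.
Qed.

Lemma mem_VQP d (p : V d) :
  reflect (if (l <= d)%N
           then exists r : V (d - l), p = (Q : {mpoly C[3]}) * r :> {mpoly C[3]}
           else p = 0)
    (p \in VQ d).
Proof.
rewrite /VQ; case: leqP => [ld|_]; last by rewrite memv0; apply: eqP.
have lin : linear (@mulQ d).
  by move=> a u v; apply: val_inj; rewrite /= !mulQE //= mulrDr scalerAr.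
pose Lm := GRing.isLinear.Build _ _ _ _ _ lin.
pose f : {linear V (d - l) -> V d} := HB.pack (@mulQ d) Lm.
have E r : linfun (@mulQ d) r = mulQ r by rewrite -[RHS]/(f r) -[LHS]/(linfun f r) lfunE.
apply: (iffP memv_imgP) => [[r _ ->]|[r Er]].
  by exists r; rewrite E mulQE.
by exists r; rewrite ?memvf // E; apply: val_inj; rewrite /= mulQE.
Qed.

Lemma VQ_orth_direct d : (VQorth d :&: VQ d = 0)%VS.
Proof. exact: cap_orthov. Qed.

Lemma VQ_orth_full d : (VQorth d + VQ d = fullv)%VS.
Proof. exact: add_orthov. Qed.

(* prod_perp P is the unique representative of \prod_i P_i modulo Q that lies
   in the orthogonal complement. *)
Lemma prod_perpP s (omega : 'I_s -> nat) d (P : forall i, VQperp (omega i)) :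
  d = (\sum_(i < s) omega i)%N ->
  exists r : {mpoly C[3]},
    \prod_(i < s) poly_of (P i) - poly_of (prod_perp d P) = (Q : {mpoly C[3]}) * r.
Proof.
move=> dE; set p := \prod_(i < s) _.
have hp : p \is d.-homog.
  rewrite dE {}/p; elim/big_rec2: _ => [|i e q _ hq]; first exact: dhomog1.
  by apply: dhomogM => //; apply: dhomog_is_dhomog.
rewrite -(indhomogK hp) /poly_of /prod_perp -/p vsprojK ?memv_pi //.
set w := indhomog d p.
have E := daddv_pi_add (VQ_orth_direct d) (_ : w \in (VQorth d + VQ d)%VS).
rewrite -{1}E ?VQ_orth_full ?memvf // raddfD /= addrC addKr.
have := memv_pi (VQ d) (VQorth d) w => /mem_VQP.
case: leqP => _; first by case=> r ->; exists r.
by move=> ->; exists 0; rewrite mulr0.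
Qed.

End SurfacePolynomials.

(* Main.v *)
From HB Require Import structures.
Require Import Defs.
From mathcomp Require Import ring boolp zify.

(** In S = C[x,y,z]/(Q), identify V_Q^perp(k) with the degree k part S_k, so that
    [prod_perp] is multiplication in S. For k >= l one has dim S_k = l k + 1 - g
    with g = (l-1)(l-2)/2 ([dim_VQperp_genus]). Put n_i = dim S_{omega_i} and
    M = 1 + sum_i (n_i - 1); then dim S_d - M = (s-1) g ([dim_count]), so the
    claim on the codimension is that the set X of products of nonzero factors has
    Krull dimension M. No finiteness of the fibres of Phi is needed: the two
    bounds are proved separately.

    Upper bound. A nonzero factor is a scalar times a point of one of the n_i
    affine charts of its space, so X is covered by the images of finitely many
    polynomial maps from C^M ([products_cover]). By a monomial count, more than M
    polynomials in M variables are algebraically dependent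
    ([algebraic_dependence]), hence so are more than M polynomial functions on X.
    But a chain of irreducible closed subsets of X of length m produces m
    independent functions, one for each step: add a function vanishing on the
    smaller set and not on the larger one ([zchain_alg_indep]). The same
    dependence applied to the coordinates of S_d gives, when s >= 2, a nonzero
    polynomial vanishing on all products of given degrees. There are finitely
    many families of degrees, which gives the generic statement and the failure
    of surjectivity.

    Lower bound. For subspaces L_i of S_{omega_i}, the trace on X of the closure
    of the set of products of elements of the L_i is irreducible, since two
    products are joined by the polynomial curve of products of
    P_i + t (P'_i - P_i). Choose nonzero P_i in L_i. As Q is prime and divides no
    P_i, there is a point v with Q(v) = 0 and P_i(v) <> 0 for all i
    ([prime_zero_point]). Cutting one L_i by the hyperplane P(v) = 0 lowers its
    dimension by one and gives a strictly smaller closed set, because evaluation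
    at v is a linear function on S_d, multiplicative on products, that vanishes
    on the smaller set and not at the product of the P_i. From L_i = S_{omega_i}
    down to lines this takes sum_i (n_i - 1) steps; a single point at the bottom
    supplies the last one ([products_chain]).

    The facts on Q, that an irreducible form is prime and that a polynomial it
    does not divide is nonzero somewhere on its zero set, follow from Gauss's
    lemma by induction on the number of variables. *)

Import Order.TTheory GRing.Theory Num.Theory.
Local Open Scope ring_scope.

Set Implicit Arguments.
Unset Strict Implicit.
Unset Printing Implicit Defensive.

(** * Gauss's lemma *)

(** Divisibility in a domain. *)
Definition divides (R : idomainType) (a b : R) := exists c, b = a * c.

(** Prime elements of a domain. *)
Definition prime_elt (R : idomainType) (p : R) :=
  [/\ p != 0, p \isn't a GRing.unit &
      forall a b, divides p (a * b) -> divides p a \/ divides p b].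

(** Irreducible elements of a domain; for polynomials over a field this is
    [irreducible_mpoly]. *)
Definition irreducible_elt (R : idomainType) (p : R) :=
  [/\ p != 0, p \isn't a GRing.unit &
      forall a b, p = a * b -> a \is a GRing.unit \/ b \is a GRing.unit].

(** Products of a unit and finitely many primes. *)
Inductive prime_product (R : idomainType) : R -> Prop :=
| PrimeProductUnit u : u \is a GRing.unit -> prime_product u
| PrimeProductMul p y : prime_elt p -> prime_product y -> prime_product (p * y).

(** Unique factorization domains, in the form that every nonzero element is a
    product of primes. *)
Definition factorial (R : idomainType) := forall x : R, x != 0 -> prime_product x.

Section Gauss.
Variable R : idomainType.
Implicit Types (p c : R) (f g h q : {poly R}).

Lemma dividesM (T : idomainType) (a b c : T) : divides a b -> divides a (b * c).
Proof. by case=> d ->; exists (d * c); rewrite mulrA. Qed.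

Lemma dividesMl (T : idomainType) (a b c : T) : divides a b -> divides a (c * b).
Proof. by rewrite mulrC; apply: dividesM. Qed.

Lemma polyC_divides p f :
  (forall i, divides p f`_i) -> divides p%:P f.
Proof.
elim/poly_ind: f => [_|f c IH pf]; first by exists 0; rewrite mulr0.
have [i|g ->] := IH.
  by have := pf i.+1; rewrite coefD coefMX coefC /= addr0.
have [d] := pf 0%N; rewrite coefD coefMX coefC /= add0r => ->.
by exists (g * 'X + d%:P); rewrite mulrDr mulrA polyCM.
Qed.

Lemma polyC_coef_divides p f i : divides p%:P f -> divides p f`_i.
Proof. by case=> g ->; rewrite coefCM; exists g`_i. Qed.

Lemma dividesB (T : idomainType) (a b c : T) :
  divides a b -> divides a c -> divides a (b - c).
Proof. by case=> d -> [e ->]; exists (d - e); rewrite mulrBr. Qed.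

(** If p divides f * g, it divides one of the two leading coefficients; the
    corresponding leading term can then be removed. *)
Lemma prime_polyC p : prime_elt p -> prime_elt p%:P.
Proof.
case=> p0 pU pP; split; first by rewrite polyC_eq0.
  by rewrite poly_unitE size_polyC p0 coefC.
have lead f g : divides p%:P (f * g) ->
    divides p (lead_coef f) \/ divides p (lead_coef g).
  move=> /(polyC_coef_divides (size f + size g).-2) H; apply: pP.
  by rewrite mul_lead_coef.
suff H n f g : (size f + size g <= n)%N -> divides p%:P (f * g) ->
    divides p%:P f \/ divides p%:P g by move=> f g; apply: (H _ _ _ (leqnn _)).
elim: n f g => [|n IH] f g.
  rewrite leqn0 addn_eq0 size_poly_eq0 => /andP[/eqP-> _] _.
  by left; exists 0; rewrite mulr0.
have [-> _ _|f0] := eqVneq f 0; first by left; exists 0; rewrite mulr0.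
have [-> _ _|g0] := eqVneq g 0; first by right; exists 0; rewrite mulr0.
move=> szn pfg.
have trunc (k : {poly R}) : k != 0 -> (size (k - (lead_coef k)%:P * 'X^((size k).-1))%R < size k)%N.
  move=> k0; rewrite -{2}(prednK (_ : 0 < size k)%N) ?size_poly_gt0 // ltnS.
  apply/leq_sizeP => j; rewrite leq_eqVlt => /orP[/eqP <-|lj].
    by rewrite coefB coefCM coefXn eqxx mulr1 subrr.
  rewrite coefB coefCM coefXn gtn_eqF // mulr0 subr0 nth_default //.
  by rewrite -(prednK (_ : 0 < size k)%N) ?size_poly_gt0.
have ld (k : {poly R}) : divides p (lead_coef k) ->
    divides p%:P ((lead_coef k)%:P * 'X^((size k).-1)).
  by case=> c ->; exists (c%:P * 'X^((size k).-1)); rewrite polyCM mulrA.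
have back (k : {poly R}) : divides p (lead_coef k) ->
   divides p%:P (k - (lead_coef k)%:P * 'X^((size k).-1)) -> divides p%:P k.
  move=> /ld [u U] [v V]; exists (u + v); rewrite mulrDr -U -V; ring.
case: (lead _ _ pfg) => L.
  case: (IH (f - (lead_coef f)%:P * 'X^((size f).-1)) g).
  - rewrite -ltnS; apply: leq_trans szn; rewrite ltn_add2r; exact: trunc.
  - by rewrite mulrBl; apply: dividesB => //; apply/dividesM/ld.
  - by move=> ?; left; apply: back.
  - by right.
case: (IH f (g - (lead_coef g)%:P * 'X^((size g).-1))).
- rewrite -ltnS; apply: leq_trans szn; rewrite ltn_add2l; exact: trunc.
- by rewrite mulrBr; apply: dividesB => //; apply/dividesMl/ld.
- by left.
- by move=> ?; right; apply: back.
Qed.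

(* From here on R has unique factorization. *)
Hypothesis facR : factorial R.

(** An irreducible q of positive degree that divides a nonzero constant multiple
    of f divides f: the primes of the constant do not divide q, so each of them
    cancels with the cofactor. *)
Lemma divides_scale q f k c : irreducible_elt q -> (1 < size q)%N -> c != 0 ->
  c%:P * f = q * k -> divides q f.
Proof.
move=> irq sq c0; elim: (facR c0) f k => [u uU|p y pp _ IH] f k E.
  by exists (u^-1%:P * k); rewrite mulrCA -E mulrA -polyCM mulVr // mul1r.
have pP := prime_polyC pp; case: (pP) => p0 pU /(_ q k) [].
- by exists (y%:P * f); rewrite -E polyCM mulrA.
- case=> q' Eq; case: irq => q0 _ /(_ _ _ Eq) [|qU].
    by move/negP: pU.
  move: sq; rewrite Eq; move: qU; rewrite poly_unitE => /andP[/size_poly1P[a a0 ->] _].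
  by rewrite -polyCM size_polyC; case: eqP.
- case=> k' Ek; apply: (IH _ k'); apply: (mulfI p0).
  by rewrite mulrA -polyCM E Ek mulrCA.
Qed.

(** An irreducible q of positive degree stays irreducible over the fraction
    field. *)
Lemma irreducible_scale_factor q g h c :
  irreducible_elt q -> (1 < size q)%N -> c != 0 -> c%:P * q = g * h ->
  (size g <= 1)%N \/ (size h <= 1)%N.
Proof.
move=> irq sq c0; elim: (facR c0) g h => [u uU|p y pp _ IH] g h E.
  have Eq : q = (u^-1%:P * g) * h by rewrite -mulrA -E mulrA -polyCM mulVr // mul1r.
  case: irq => _ _ /(_ _ _ Eq) []; rewrite poly_unitE => /andP[/eqP S _].
    left; rewrite mul_polyC size_scale // in S; first by rewrite S.
    by rewrite invr_eq0; apply: contraTneq uU => ->; rewrite unitr0.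
  by right; rewrite S.
have [p0 pU] := prime_polyC pp; have pR : p != 0 by case: pp.
case/(_ g h).
- by exists (y%:P * q); rewrite -E polyCM mulrA.
- case=> g' Eg; case: (IH g' h); first apply: (mulfI p0).
  + by rewrite mulrA -polyCM E Eg mulrA.
  + by move=> S; left; rewrite Eg mul_polyC size_scale.
  + by right.
- case=> h' Eh; case: (IH g h'); first apply: (mulfI p0).
  + by rewrite mulrA -polyCM E Eh mulrCA.
  + by left.
  + by move=> S; right; rewrite Eh mul_polyC size_scale.
Qed.

(** An irreducible q of positive degree and a polynomial that q does not divide
    are coprime over the fraction field; clearing denominators gives a nonzero
    constant in the ideal they generate. *)
Lemma irreducible_Bezout q f : irreducible_elt q -> (1 < size q)%N ->
  ~ divides q f -> exists a b c, c != 0 /\ a * f + b * q = c%:P.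
Proof.
move=> irq sq nqf; have q0 : q != 0 by case: irq.
have cop : coprimep f q.
  rewrite coprimep_def; set g := gcdp f q.
  have g0 : g != 0 by rewrite gcdp_eq0 negb_and q0 orbT.
  have [[c1 h1] c10 E1] := Pdiv.WeakIdomain.dvdpP g q (dvdp_gcdr f q).
  have [[c2 h2] c20 E2] := Pdiv.WeakIdomain.dvdpP g f (dvdp_gcdl f q).
  rewrite /= -mul_polyC in c10 E1; rewrite /= -mul_polyC in c20 E2.
  case: (irreducible_scale_factor irq sq c10 E1) => S; last first.
    by rewrite eqn_leq S size_poly_gt0.
  have [a Ea] : exists a, h1 = a%:P by exists h1`_0; apply: size1_polyC.
  have a0 : a != 0.
    apply/eqP => Z; move/eqP: E1.
    by rewrite Ea Z mul0r mulf_eq0 polyC_eq0 (negPf c10) (negPf q0).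
  case: nqf; apply: (@divides_scale q f (c1%:P * h2) (a * c2)) => //.
    by rewrite mulf_neq0.
  by rewrite polyCM -mulrA E2 mulrCA -Ea -E1; ring.
have [[u v]] := Bezoutp f q; rewrite /= => H.
have := eqp_trans H (_ : gcdp f q %= 1); rewrite gcdp_eqp1 => /(_ cop).
rewrite -size_poly_eq1 => /size_poly1P[c c0 E].
by exists u, v, c.
Qed.

Lemma irreducible_prime_poly q : irreducible_elt q -> prime_elt q.
Proof.
move=> irq; have [q0 qU qI] := irq.
case: (ltnP 1 (size q)) => sq.
  split=> // f h [k E].
  have [?|nqf] := pselect (divides q f); [by left | right].
  have [a [b [c [c0 B]]]] := irreducible_Bezout irq sq nqf.
  apply: (@divides_scale q h (a * k + b * h) c) => //.
  rewrite -B mulrDl mulrDr -mulrA E; ring.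
have [a Ea] : exists a, q = a%:P by exists q`_0; apply: size1_polyC.
rewrite Ea in q0 qU qI *; rewrite polyC_eq0 in q0.
have aU : a \isn't a GRing.unit by move: qU; rewrite poly_unitE size_polyC q0 coefC.
apply: prime_polyC; case: (facR q0) aU qI => [u ->//|p y pp py _ qI].
have [p0 pU pP] := pp.
have [||yU] := qI p%:P y%:P; first by rewrite polyCM.
  by rewrite poly_unitE size_polyC p0 coefC /= (negPf pU).
have yu : y \is a GRing.unit by move: yU; rewrite poly_unitE size_polyC coefC => /andP[].
have E : divides p (p * y) by exists y.
have E' x : divides (p * y) x <-> divides p x.
  split; first by case=> z ->; exists (y * z); rewrite mulrA.
  by case=> z ->; exists (y^-1 * z); rewrite -mulrA mulVKr.
split.
- by rewrite mulf_neq0 //; apply: contraTneq yu => ->; rewrite unitr0.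
- by rewrite unitrM negb_and pU.
- by move=> x z /E' /pP [] /E'; [left|right].
Qed.

End Gauss.

(** * Irreducible polynomials in several variables *)

Section MuniIso.
Variables (n : nat) (R : idomainType).
Local Notation widen := (widen_ord (leqnSn n)).

Lemma muniXmax : muni ('X_ord_max : {mpoly R[n.+1]}) = 'X.
Proof.
rewrite muniE msuppX big_seq1 mcoeffX eqxx !scale1r mnm1E eqxx expr1.
rewrite (_ : [multinom _ | i < n] = 0%MM) ?mpolyX0 ?scale1r //.
by apply/mnmP => i; rewrite mnmE mnm1E mnm0E -val_eqE /= gtn_eqF.
Qed.

Lemma muniX (i : 'I_n) : muni ('X_(widen i) : {mpoly R[n.+1]}) = ('X_i)%:P.
Proof.
rewrite muniE msuppX big_seq1 mcoeffX eqxx !scale1r mnm1E.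
rewrite -val_eqE /= ltn_eqF // expr0 (_ : [multinom _ | i < n] = U_(i)%MM).
  by rewrite -mul_polyC mulr1.
by apply/mnmP => j; rewrite mnmE !mnm1E -!val_eqE.
Qed.

(** Ring morphisms out of a polynomial ring are determined by the images of the
    constants and of the variables. *)
Lemma mpoly_morphE (m : nat) (S : comNzRingType) (f g : {rmorphism {mpoly R[m]} -> S}) :
  (forall c, f c%:MP = g c%:MP) -> (forall i, f 'X_i = g 'X_i) -> f =1 g.
Proof.
move=> fgC fgX p; rewrite [p]mpolyE !raddf_sum /=; apply: eq_bigr => e _.
rewrite -mul_mpolyC !rmorphM /= fgC mpolyXE_id !rmorph_prod; congr (_ * _).
by apply: eq_bigr => i _; rewrite !rmorphXn /= fgX.
Qed.

Lemma ord_widenP (i : 'I_n.+1) : i = ord_max \/ exists j, i = widen j.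
Proof.
have := ltn_ord i; rewrite ltnS leq_eqVlt => /orP[/eqP E|lt_in].
  by left; apply: val_inj.
by right; exists (Ordinal lt_in); apply: val_inj.
Qed.

(** The inverse of [muni]: substitution of the last variable in a univariate
    polynomial with coefficients in the other ones. *)
Definition unmuni (q : {poly {mpoly R[n]}}) : {mpoly R[n.+1]} :=
  (map_poly (@mwiden n R) q).['X_ord_max].

HB.instance Definition _ := GRing.RMorphism.copy unmuni
  (horner_eval ('X_ord_max : {mpoly R[n.+1]}) \o map_poly (@mwiden n R)).

Lemma unmuniC c : unmuni c%:P = mwiden c.
Proof. by rewrite /unmuni map_polyC hornerC. Qed.

Lemma unmuniX : unmuni 'X = 'X_ord_max.
Proof. by rewrite /unmuni map_polyX hornerX. Qed.

Lemma mwidenXU i : mwiden ('X_i : {mpoly R[n]}) = 'X_(widen i).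
Proof. by rewrite mwidenX mnmwiden1. Qed.

Lemma muniK : cancel (@muni n R) unmuni.
Proof.
apply: (mpoly_morphE (f := unmuni \o @muni n R) (g := idfun)) => [c|i] /=.
  by rewrite muniC unmuniC mwidenC.
have [->|[j ->]] := ord_widenP i; first by rewrite muniXmax unmuniX.
by rewrite muniX unmuniC mwidenXU.
Qed.

Lemma muni_mwiden p : muni (mwiden p) = p%:P :> {poly {mpoly R[n]}}.
Proof.
apply: (mpoly_morphE (f := @muni n R \o @mwiden n R) (g := polyC)) => [c|i] /=.
  by rewrite mwidenC muniC.
by rewrite mwidenXU muniX.
Qed.

Lemma unmuniK : cancel unmuni (@muni n R).
Proof.
elim/poly_ind => [|q c IH]; first by rewrite !rmorph0.
by rewrite rmorphD rmorphM rmorphD rmorphM /= IH unmuniX muniXmax unmuniC muni_mwiden.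
Qed.

Lemma meval_muni (v : 'I_n.+1 -> R) p :
  p.@[v] = (map_poly (meval (v \o widen)) (muni p)).[v ord_max].
Proof.
pose f : {rmorphism {mpoly R[n.+1]} -> R} :=
  horner_eval (v ord_max) \o map_poly (meval (v \o widen)) \o @muni n R.
apply: (mpoly_morphE (f := meval v) (g := f)) => [c|i]; rewrite /f /= /horner_eval.
  by rewrite muniC map_polyC hornerC mevalC; apply/esym/mevalC.
rewrite mevalXU; have [->|[j ->]] := ord_widenP i.
  by rewrite muniXmax map_polyX hornerX.
by rewrite muniX map_polyC hornerC; apply/esym/mevalXU.
Qed.

Lemma muni_unit (p : {mpoly R[n.+1]}) : (muni p \is a GRing.unit) = (p \is a GRing.unit).
Proof.
apply/idP/idP => U; last exact: rmorph_unit.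
by rewrite -[p]muniK rmorph_unit.
Qed.

Lemma muni_divides (p q : {mpoly R[n.+1]}) : divides (muni p) (muni q) <-> divides p q.
Proof.
split=> [[r E]|[r ->]]; last by exists (muni r); rewrite rmorphM.
by exists (unmuni r); apply: (can_inj muniK); rewrite rmorphM /= unmuniK.
Qed.

Lemma muni_eq0 (p : {mpoly R[n.+1]}) : (muni p == 0) = (p == 0).
Proof. by rewrite -(inj_eq (can_inj muniK)) muni0. Qed.

Lemma muni_irreducible (p : {mpoly R[n.+1]}) : irreducible_elt p -> irreducible_elt (muni p).
Proof.
case=> p0 pU pI; split; rewrite ?muni_eq0 ?muni_unit // => a b E.
have Eu (c : {poly {mpoly R[n]}}) : (c \is a GRing.unit) = (unmuni c \is a GRing.unit).
  by rewrite -{1}(unmuniK c) (muni_unit (unmuni c)).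
rewrite (Eu a) (Eu b); apply: pI.
by apply: (can_inj muniK); rewrite rmorphM /= !unmuniK.
Qed.

Lemma muni_prime (p : {mpoly R[n.+1]}) : prime_elt (muni p) -> prime_elt p.
Proof.
rewrite /prime_elt muni_eq0 muni_unit => -[p0 pU pP]; split=> // a b.
by rewrite -!muni_divides rmorphM => /pP.
Qed.

Lemma prime_muni (p : {mpoly R[n.+1]}) : prime_elt p -> prime_elt (muni p).
Proof.
rewrite /prime_elt muni_eq0 muni_unit => -[p0 pU pP]; split=> // a b.
have Ed (c : {poly {mpoly R[n]}}) : divides (muni p) c <-> divides p (unmuni c).
  by rewrite -{1}(unmuniK c) (muni_divides p (unmuni c)).
by move=> /Ed; rewrite rmorphM => /pP[] /Ed; [left|right].
Qed.

End MuniIso.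

Section Factorial.
Variable K : fieldType.

Lemma mpoly0_const (p : {mpoly K[0]}) : p = (p@_0)%:MP.
Proof.
apply/mpolyP => m; rewrite mcoeffC (_ : m = 0%MM) ?eqxx ?mulr1 //.
by apply/mnmP => -[].
Qed.

Lemma mpolyC_unit n (c : K) : c != 0 -> (c%:MP : {mpoly K[n]}) \is a GRing.unit.
Proof. by move=> c0; rewrite rmorph_unit // unitfE. Qed.

Lemma mpoly_unit_msize n (p : {mpoly K[n]}) :
  p != 0 -> (p \is a GRing.unit) = (msize p <= 1)%N.
Proof.
move=> p0; apply/idP/idP => [|/msize1_polyC E]; last first.
  by rewrite E mpolyC_unit //; apply: contraNneq p0 => Z; rewrite E Z.
by case/andP => /eqP -> _; rewrite msizeC leq_b1.
Qed.

Lemma irreducible_factor n (p : {mpoly K[n]}) : p != 0 -> p \isn't a GRing.unit ->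
  exists q r, irreducible_elt q /\ p = q * r.
Proof.
move: {2}(msize p) (leqnn (msize p)) => N.
elim: N p => [|N IH] p sz p0 pU.
  by rewrite leqn0 msize_poly_eq0 (negPf p0) in sz.
have [irr|nirr] := pselect (irreducible_elt p); first by exists p, 1; rewrite mulr1.
have [a [b [E aU bU]]] : exists a b, [/\ p = a * b, a \isn't a GRing.unit & b \isn't a GRing.unit].
  apply: contrapT => H; apply: nirr; split=> // a b E.
  apply: contrapT => nU; apply: H; exists a, b; split=> //; apply/negP => U; apply: nU; tauto.
have a0 : a != 0 by apply: contraNneq p0 => Z; rewrite E Z mul0r.
have b0 : b != 0 by apply: contraNneq p0 => Z; rewrite E Z mulr0.
have [|//||q [r [irr Ea]]] := IH a.
- rewrite mpoly_unit_msize // -ltnNge in bU; rewrite E msizeM // in sz.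
  rewrite -ltnS; apply: leq_trans sz.
  by case: (msize b) bU => [//|[//|k]] _; rewrite !addnS /= ltnS leq_addr.
- by [].
by exists q, (r * b); split=> //; rewrite E Ea mulrA.
Qed.

(** By induction on the degree a nonzero polynomial is a product of irreducible
    ones, so unique factorization only needs these to be prime. *)
Lemma mpoly_factorial_of_prime n :
  (forall q : {mpoly K[n]}, irreducible_elt q -> prime_elt q) -> factorial {mpoly K[n]}.
Proof.
move=> irr_prime x; move: {2}(msize x) (leqnn (msize x)) => N.
elim: N x => [|N IHN] x sz x0.
  by rewrite leqn0 msize_poly_eq0 (negPf x0) in sz.
have [xU|xU] := boolP (x \is a GRing.unit); first exact: PrimeProductUnit.
have [p [r [irp E]]] := irreducible_factor x0 xU.
have p0 : p != 0 by apply: contraNneq x0 => Z; rewrite E Z mul0r.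
have r0 : r != 0 by apply: contraNneq x0 => Z; rewrite E Z mulr0.
rewrite E; apply: PrimeProductMul; first exact: irr_prime.
apply: IHN => //; rewrite -ltnS; apply: leq_trans sz; rewrite E msizeM //.
have : p \isn't a GRing.unit by case: irp.
rewrite mpoly_unit_msize // -ltnNge.
by case: (msize p) => [//|[//|k]] _; rewrite !addSn /= ltnS leq_addl.
Qed.

(** Irreducible polynomials in n variables over a field are prime. *)
Theorem irreducible_prime n (q : {mpoly K[n]}) : irreducible_elt q -> prime_elt q.
Proof.
elim: n q => [|n IH] q irq.
  case: irq => q0 /negP[]; rewrite mpoly_unit_msize // [q]mpoly0_const msizeC.
  exact: leq_b1.
apply: muni_prime; apply: irreducible_prime_poly (muni_irreducible irq).
exact: mpoly_factorial_of_prime.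
Qed.

Lemma prime_irreducible (R : idomainType) (p : R) : prime_elt p -> irreducible_elt p.
Proof.
case=> p0 pU pP; split=> // a b E.
have : divides p (a * b) by exists 1; rewrite mulr1 E.
case/pP => -[c C]; [right|left]; apply/unitrP; exists c.
  have : a * (b * c) = a by rewrite mulrA -E -C.
  have a0 : a != 0 by apply: contraNneq p0 => Z; rewrite E Z mul0r.
  by rewrite -[RHS]mulr1 => /(mulfI a0) H; split; first rewrite mulrC.
have : b * (a * c) = b by rewrite mulrA (mulrC b) -E -C.
have b0 : b != 0 by apply: contraNneq p0 => Z; rewrite E Z mulr0.
by rewrite -[RHS]mulr1 => /(mulfI b0) H; split; first rewrite mulrC.
Qed.

End Factorial.

Section ExtendPoint.
Variable K : fieldType.

(** The point of K^(n+1) with last coordinate x and the other ones given by v. *)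
Definition extend_point n (v : 'I_n -> K) (x : K) (i : 'I_n.+1) : K :=
  if unlift ord_max i is Some j then v j else x.

Lemma meval_extend n (p : {mpoly K[n.+1]}) v x :
  p.@[extend_point v x] = (map_poly (meval v) (muni p)).[x].
Proof.
rewrite meval_muni {2}/extend_point unlift_none.
congr (_.[x]); apply: eq_map_poly => c; apply: meval_eq => i /=.
rewrite /extend_point; case: unliftP => [j /(congr1 val)|/(congr1 val)] /=.
  by rewrite /bump leqNgt ltn_ord add0n => /val_inj ->.
by move/eqP; rewrite ltn_eqF.
Qed.

End ExtendPoint.

Section Nullstellensatz.
Variable K : closedFieldType.

(** Polynomials over an algebraically closed, hence infinite, field are
    determined by their values. *)
Lemma mpoly_nonzero_point n (p : {mpoly K[n]}) : p != 0 -> exists v, p.@[v] != 0.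
Proof.
elim: n p => [|n IH] p p0.
  exists (fun=> 0); rewrite [p]mpoly0_const mevalC.
  by apply: contraNneq p0 => Z; rewrite [p]mpoly0_const Z mpolyC0.
have lc0 : lead_coef (muni p) != 0 by rewrite lead_coef_eq0 muni_eq0.
have [v v0] := IH _ lc0.
have : map_poly (meval v) (muni p) != 0.
  by rewrite -size_poly_eq0 size_map_poly_id0 // size_poly_eq0 muni_eq0.
move=> /closed_nonrootP [x]; rewrite /root => x0.
by exists (extend_point v x); rewrite meval_extend.
Qed.

(** A common zero of f and g kills every constant in the ideal they generate. *)
Lemma horner_map_Bezout n (v : 'I_n -> K) x (a b f g : {poly {mpoly K[n]}}) c :
  a * f + b * g = c%:P ->
  (map_poly (meval v) f).[x] = 0 -> (map_poly (meval v) g).[x] = 0 -> c.@[v] = 0.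
Proof.
move=> E fx gx.
have H : (map_poly (meval v) (a * f + b * g)).[x] = 0.
  by rewrite rmorphD !rmorphM /= hornerD !hornerM fx gx !mulr0 addr0.
by move: H; rewrite E map_polyC hornerC.
Qed.

(** Nullstellensatz for a hypersurface: a polynomial f not divisible by the prime
    q is nonzero at some zero of q. If q involves the last variable, eliminate it
    from f and q to get a nonzero c in the other variables, take a point where
    neither c nor the leading coefficient of q vanishes, and solve for the last
    coordinate. Otherwise, use induction for q and a coefficient of f. *)
Theorem prime_zero_point n (q f : {mpoly K[n]}) : prime_elt q -> ~ divides q f ->
  exists v, q.@[v] = 0 /\ f.@[v] != 0.
Proof.
elim: n q f => [|n IH] q f prq nqf.
  case: prq => q0 + _; rewrite mpoly_unit_msize // [q]mpoly0_const msizeC.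
  by rewrite leq_b1.
have irq := muni_irreducible (prime_irreducible prq).
have nqf' : ~ divides (muni q) (muni f) by move/muni_divides.
case: (ltnP 1 (size (muni q))) => sq.
  have [a [b [c [c0 E]]]] :=
    irreducible_Bezout (mpoly_factorial_of_prime (@irreducible_prime K n)) irq sq nqf'.
  have lq0 : lead_coef (muni q) != 0 by rewrite lead_coef_eq0; case: irq.
  have [v] := mpoly_nonzero_point (mulf_neq0 c0 lq0).
  rewrite mevalM mulf_eq0 negb_or => /andP[cv lv].
  have : size (map_poly (meval v) (muni q)) != 1%N.
    by rewrite size_map_poly_id0 // gtn_eqF.
  move=> /closed_rootP [x /rootP qx]; exists (extend_point v x); rewrite !meval_extend.
  split=> //; apply: contraNneq cv => fx.
  apply/eqP; exact: horner_map_Bezout E fx qx.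
have [c Ec] : exists c, muni q = c%:P by exists (muni q)`_0; apply: size1_polyC.
have prc : prime_elt c.
  have [q0 qU qP] := prime_muni prq; rewrite Ec in q0 qU qP.
  have c0 : c != 0 by rewrite polyC_eq0 in q0.
  split=> //; first by move: qU; rewrite poly_unitE size_polyC c0 coefC.
  move=> a b [d D]; case: (qP a%:P b%:P).
  - by exists d%:P; rewrite -!polyCM D.
  - by move/(polyC_coef_divides 0); rewrite coefC; left.
  - by move/(polyC_coef_divides 0); rewrite coefC; right.
have [i nci] : exists i, ~ divides c (muni f)`_i.
  apply: contrapT => H; apply: nqf'; rewrite Ec; apply: polyC_divides => i.
  by apply: contrapT => H'; apply: H; exists i.
have [v [cv fv]] := IH _ _ prc nci.
have : map_poly (meval v) (muni f) != 0.
  apply: contraNneq fv => /(congr1 (fun g : {poly K} => g`_i)).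
  by rewrite coef_map coef0 => /eqP.
move=> /closed_nonrootP [x]; rewrite /root => x0.
exists (extend_point v x); rewrite !meval_extend; split=> //.
by rewrite Ec map_polyC hornerC.
Qed.

End Nullstellensatz.

(** * Algebraic dependence *)

Section AlgebraicDependence.
Variable K : fieldType.

Lemma msizeM_deg n (p q : {mpoly K[n]}) a b :
  (msize p <= a.+1)%N -> (msize q <= b.+1)%N -> (msize (p * q) <= (a + b).+1)%N.
Proof.
move=> pa qb.
have [->|p0] := eqVneq p 0; first by rewrite mul0r msize0.
have [->|q0] := eqVneq q 0; first by rewrite mulr0 msize0.
rewrite msizeM // -subn1 leq_subLR add1n.
by rewrite -addnS -addSn leq_add.
Qed.

Lemma msize_prod_deg n m (p : 'I_m -> {mpoly K[n]}) (e : 'I_m -> nat) d t :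
  (forall i, msize (p i) <= d.+1)%N -> (forall i, e i <= t)%N ->
  (msize (\prod_i p i ^+ e i) <= (m * t * d).+1)%N.
Proof.
move=> pd et; have H i : (msize (p i ^+ e i) <= (t * d).+1)%N.
  apply: (@leq_trans (e i * d).+1); last by rewrite ltnS leq_mul2r et orbT.
  elim: (e i) => [|k IH]; first by rewrite expr0 msize1.
  by rewrite exprS mulSn msizeM_deg.
elim: m p e pd et H => [|m IH] p e pd et H; first by rewrite big_ord0 msize1.
by rewrite big_ord_recl -mulnA mulSn msizeM_deg // mulnA IH.
Qed.

(** The monomials with all exponents at most t. *)
Definition box_mnm n t (h : {ffun 'I_n -> 'I_t.+1}) : 'X_{1..n} :=
  [multinom (h i : nat) | i < n].

Lemma box_mnm_inj n t : injective (@box_mnm n t).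
Proof.
move=> h h' /mnmP E; apply/ffunP => i; apply: val_inj.
by have := E i; rewrite !mnmE.
Qed.

Lemma mnm_boxP n t (m : 'X_{1..n}) : (mdeg m <= t)%N -> exists h, m = @box_mnm n t h.
Proof.
move=> mt; exists [ffun i => inord (m i)]; apply/mnmP => i.
rewrite mnmE ffunE inordK // ltnS; apply: leq_trans mt.
by rewrite mdegE (bigD1 i) //= leq_addr.
Qed.

(** Counting: the (t+1)^m monomials of exponents at most t in the g_j lie in a
    space of polynomials of dimension O(t^M), too small once M < m and t is large. *)
Theorem algebraic_dependence m M (g : 'I_m -> {mpoly K[M]}) : (M < m)%N ->
  exists2 G : {mpoly K[m]}, G != 0 &
    forall a, G.@[fun j => (g j).@[a]] = 0.
Proof.
move=> ltMm.
(* d bounds the degrees of the g_j, so that J bounds those of the monomials with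
   exponents at most t in the g_j; t makes (J+1)^M < (t+1)^m. *)
pose d := \max_j msize (g j).
pose t := ((m * d).+1 ^ M)%N; pose J := (m * t * d)%N.
pose lg := [tuple g j | j < m].
have gd j : (msize (g j) <= d.+1)%N by apply: leqW; apply: leq_bigmax.
pose A : 'M[K]_(#|{: {ffun 'I_m -> 'I_t.+1}}|, #|{: {ffun 'I_M -> 'I_J.+1}}|) :=
  \matrix_(a, b) ('X_[box_mnm (enum_val a)] \mPo lg)@_(box_mnm (enum_val b)).
have szA : (#|{: {ffun 'I_M -> 'I_J.+1}}| < #|{: {ffun 'I_m -> 'I_t.+1}}|)%N.
  rewrite !card_ffun !card_ord.
  have JE : (J.+1 <= (m * d).+1 * t.+1)%N by rewrite /J; nia.
  apply: (@leq_ltn_trans ((m * d).+1 ^ M * t.+1 ^ M)).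
    rewrite -expnMn; have H k : (J.+1 ^ k <= ((m * d).+1 * t.+1) ^ k)%N.
      by elim: k => // k IH; rewrite !expnS leq_mul.
    exact: H.
  rewrite -/t; apply: (@leq_trans (t.+1 ^ M.+1)); last by rewrite leq_pexp2l.
  by rewrite expnS ltn_pmul2r // expn_gt0.
(* A row vector in the kernel of A is a relation: its entries are the
   coefficients of G, and A expresses the substitution of g on monomials. *)
have kA : kermx A != 0.
  rewrite -mxrank_eq0 mxrank_ker -lt0n subn_gt0.
  exact: leq_ltn_trans (rank_leq_col A) szA.
have [i ui0] : exists i, row i (kermx A) != 0.
  apply: contrapT => H; case/negP: kA; apply/eqP/row_matrixP => i; rewrite row0.
  by apply/eqP; apply: contrapT => /negP H'; apply: H; exists i.
set u := row i (kermx A) in ui0.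
have uA : u *m A = 0 by rewrite -row_mul mulmx_ker row0.
pose G : {mpoly K[m]} := \sum_a u 0 a *: 'X_[box_mnm (enum_val a)].
have GE a : G@_(box_mnm (enum_val a)) = u 0 a.
  rewrite /G raddf_sum (bigD1 a) //= mcoeffZ mcoeffX eqxx mulr1 big1 ?addr0 // => b ba.
  rewrite mcoeffZ mcoeffX (inj_eq (@box_mnm_inj _ _)) (inj_eq enum_val_inj).
  by rewrite (negPf ba) mulr0.
exists G.
  apply: contraNneq ui0 => G0; apply/eqP/rowP => a.
  by rewrite -GE G0 mcoeff0 mxE.
move=> a; have -> : G.@[fun j => (g j).@[a]] = (G \mPo lg).@[a].
  by rewrite comp_mpoly_meval; apply: meval_eq => j; rewrite tnth_mktuple.
rewrite (_ : G \mPo lg = 0) ?meval0 //; apply/mpolyP => mn; rewrite mcoeff0.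
have -> : G \mPo lg = \sum_a u 0 a *: ('X_[box_mnm (enum_val a)] \mPo lg).
  rewrite /G (raddf_sum (comp_mpoly lg)) /=.
  by apply: eq_bigr => b _; rewrite comp_mpolyZ.
rewrite raddf_sum /=.
have [mJ|mJ] := leqP (mdeg mn) J.
  have [h ->] := mnm_boxP mJ.
  have /matrixP/(_ 0 (enum_rank h)) := uA; rewrite mxE [RHS]mxE => E.
  rewrite -[RHS]E; apply: eq_bigr => b _.
  by rewrite mcoeffZ [A _ _]mxE enum_rankK.
apply: big1 => b _; rewrite mcoeffZ.
rewrite memN_msupp_eq0 ?mulr0 //; apply: msize_mdeg_ge; apply: leq_trans mJ.
rewrite comp_mpolyX; apply: msize_prod_deg => j; first by rewrite tnth_mktuple.
by rewrite mnmE -ltnS.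
Qed.

End AlgebraicDependence.

(** * Krull dimension of the Zariski topology *)

Section KrullDimension.
Variables (K : fieldType) (V : vectType K).
Local Notation D := (\dim {:V}).
Implicit Types (X Z Y : V -> Prop) (f g : {mpoly K[D]}).

Lemma polyfunM f g v : polyfun (f * g) v = polyfun f v * polyfun g v.
Proof. exact: mevalM. Qed.

Lemma zclosed_polyfun f : zclosed (fun v => polyfun f v = 0).
Proof. by exists (eq f) => v; split=> [fv _ <-|]; [|apply]. Qed.

(** The polynomial functions y_j satisfy no polynomial relation on Z. *)
Definition alg_indep_on Z m (y : 'I_m -> {mpoly K[D]}) :=
  forall G : {mpoly K[m]}, G != 0 ->
    exists2 v, Z v & G.@[fun j => polyfun (y j) v] != 0.

Lemma polyfun_subst m (G : {mpoly K[m]}) (y : 'I_m -> {mpoly K[D]}) :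
  exists f, forall v, polyfun f v = G.@[fun j => polyfun (y j) v].
Proof.
exists (G \mPo [tuple y j | j < m]) => v.
by rewrite /polyfun comp_mpoly_meval; apply: meval_eq => j; rewrite tnth_mktuple.
Qed.

(** A step of a chain adds a transcendental: if the y_j are independent on Z and
    f vanishes on Z but not on the irreducible Z' containing Z, then the y_j
    and f are independent on Z'. *)
Lemma alg_indep_step Z Z' m (y : 'I_m -> {mpoly K[D]}) f :
  alg_indep_on Z y -> zirreducible Z' -> (forall v, Z v -> Z' v) ->
  (forall v, Z v -> polyfun f v = 0) -> (exists2 v, Z' v & polyfun f v != 0) ->
  exists y' : 'I_m.+1 -> {mpoly K[D]}, alg_indep_on Z' y'.
Proof.
move=> indep [_ irr] sub fZ [w Zw fw].
pose y' i := if unlift ord_max i is Some j then y j else f.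
have evy v : (fun i => polyfun (y' i) v) =1
    extend_point (fun j => polyfun (y j) v) (polyfun f v).
  by move=> i; rewrite /y' /extend_point; case: unlift.
pose val (P : {poly {mpoly K[m]}}) v :=
  (map_poly (meval (fun j => polyfun (y j) v)) P).[polyfun f v].
have evG (G : {mpoly K[m.+1]}) v : G.@[fun i => polyfun (y' i) v] = val (muni G) v.
  by rewrite (meval_eq _ (evy v)) meval_extend.
have valE P c v : val (P * 'X + c%:P) v =
    val P v * polyfun f v + c.@[fun j => polyfun (y j) v].
  by rewrite /val rmorphD rmorphM /= map_polyX map_polyC hornerMXaddC.
exists y' => G G0.
suff [v Zv vP] : exists2 v, Z' v & val (muni G) v != 0 by exists v; rewrite ?evG.
have : muni G != 0 by rewrite muni_eq0.
(* Write the relation as P(f) * f + c. If c <> 0, it is nonzero somewhere on Z,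
   where f = 0; otherwise P(f) and f are both nonzero on the irreducible Z'. *)
elim/poly_ind: (muni G) => [|P c IH]; first by rewrite eqxx.
have [->|c0 _] := eqVneq c 0; last first.
  have [v Zv cv] := indep _ c0; exists v; first exact: sub.
  by rewrite (valE P c v) fZ // mulr0 add0r.
rewrite addr0 mulf_eq0 polyX_eq0 orbF => /IH[u Zu Pu].
have [F FE] := polyfun_subst (unmuni P) y'.
have FP v : polyfun F v = val P v by rewrite FE evG unmuniK.
apply: contrapT => H.
have [v Zv|H1|H2] := irr _ _ (zclosed_polyfun F) (zclosed_polyfun f).
- rewrite FP; have : val (P * 'X + 0%:P) v = 0.
    by apply: contrapT => /eqP nz; apply: H; exists v; rewrite // -[_ * 'X]addr0 -polyC0.
  rewrite (valE P 0 v) meval0 addr0 => /eqP.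
  by rewrite mulf_eq0 => /orP[] /eqP; [left|right].
- by have := H1 u Zu; rewrite FP => /eqP; rewrite (negPf Pu).
- by have := H2 w Zw => /eqP; rewrite (negPf fw).
Qed.

(** The top of a chain of length n carries n independent functions. *)
Lemma zchain_alg_indep X n (Z : nat -> V -> Prop) : zchain X n Z ->
  exists y : 'I_n -> {mpoly K[D]}, alg_indep_on (Z n) y.
Proof.
elim: n => [|n IH] [cl st].
  have [_ [[v Zv] _]] := cl 0%N isT.
  exists (fun=> 0) => G G0; exists v => //.
  by rewrite [G]mpoly0_const mevalC; apply: contraNneq G0 => E; rewrite [G]mpoly0_const E mpolyC0.
have [|y indep] := IH; first by split=> i lei; [apply: cl; apply: leqW|apply: st; apply: leqW].
have [[Y [S SP] YP] _] := cl n (leqnSn n).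
have [[Y' _ YP'] irr] := cl n.+1 (leqnn _).
have [sub [w Zw nZw]] := st n (leqnn _).
have [f Sf fw] : exists2 f, S f & polyfun f w != 0.
  apply: contrapT => H; apply: nZw; apply/YP; split; first by case/YP': Zw.
  apply/SP => f Sf; apply: contrapT => /eqP fw; apply: H; by exists f.
apply: alg_indep_step indep irr sub _ (ex_intro2 _ _ w Zw fw) => v /YP[_ /SP]; exact.
Qed.

(** Maps from K^M to V with polynomial coordinates. *)
Definition polynomial_map M (phi : ('I_M -> K) -> V) :=
  forall i, exists h : {mpoly K[M]}, forall a, coord (vbasis {:V}) i (phi a) = h.@[a].

(** X is covered by the images of finitely many polynomial maps from K^M. *)
Definition param_cover M X := exists (J : finType) (phi : J -> ('I_M -> K) -> V),
  (forall j, polynomial_map (phi j)) /\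
  forall v, X v -> exists j a, v = phi j a.

(** Polynomial functions pull back to polynomials along polynomial maps. *)
Lemma polynomial_mapE M phi f : @polynomial_map M phi ->
  exists h : {mpoly K[M]}, forall a, polyfun f (phi a) = h.@[a].
Proof.
move=> /fin_all_exists[h hP]; exists (f \mPo [tuple h i | i < D]) => a.
rewrite comp_mpoly_meval /polyfun; apply: meval_eq => i.
by rewrite tnth_mktuple hP.
Qed.

(** A relation for each map of the cover; their product holds on all of X. *)
Lemma param_cover_dependent M X m (y : 'I_m -> {mpoly K[D]}) :
  param_cover M X -> (M < m)%N ->
  exists2 G : {mpoly K[m]}, G != 0 &
    forall v, X v -> G.@[fun j => polyfun (y j) v] = 0.
Proof.
case=> J [phi [pphi cov]] ltMm.
have dep j : exists G : {mpoly K[m]}, G != 0 /\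
    forall a, G.@[fun k => polyfun (y k) (phi j a)] = 0.
  have /fin_all_exists[g gP] k := polynomial_mapE (y k) (pphi j).
  have [G G0 GP] := algebraic_dependence g ltMm; exists G; split=> // a.
  by rewrite -[RHS](GP a); apply: meval_eq => k.
have /fin_all_exists[G GP] := dep; exists (\prod_j G j).
  by apply/prodf_neq0 => j _; case: (GP j).
move=> v /cov[j [a ->]]; rewrite rmorph_prod (bigD1 j) //=.
by case: (GP j) => _ ->; rewrite mul0r.
Qed.

Lemma zchain_le M X m (Z : nat -> V -> Prop) : param_cover M X -> zchain X m Z -> (m <= M)%N.
Proof.
move=> cov ch; rewrite leqNgt; apply/negP => ltMm.
have [y indep] := zchain_alg_indep ch.
have [G G0 GP] := param_cover_dependent y cov ltMm.
have [v Zv] := indep _ G0; rewrite GP ?eqxx //.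
by have [/(_ m (leqnn m))[[Y _ /(_ v)[/(_ Zv)[]]]]] := ch.
Qed.

Lemma param_cover_vanishing M X : param_cover M X -> (M < D)%N ->
  exists2 f, f != 0 & forall v, X v -> polyfun f v = 0.
Proof.
move=> cov ltMD; have [f f0 fP] := param_cover_dependent (fun i => 'X_i) cov ltMD.
exists f => // v /fP E; rewrite -[RHS]E; apply: meval_eq => i.
by rewrite /polyfun mevalXU.
Qed.

(** Zariski closure. *)
Definition zclosure Y v := forall f, (forall u, Y u -> polyfun f u = 0) -> polyfun f v = 0.

Lemma zclosed_zclosure Y : zclosed (zclosure Y).
Proof. by exists (fun f => forall u, Y u -> polyfun f u = 0). Qed.

Lemma sub_zclosure Y v : Y v -> zclosure Y v.
Proof. by move=> Yv f; apply. Qed.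

Lemma zclosure_min Y Z : zclosed Z -> (forall v, Y v -> Z v) ->
  forall v, zclosure Y v -> Z v.
Proof.
case=> S SP YZ v cv; apply/SP => f Sf; apply: cv => u /YZ /SP; exact.
Qed.

Lemma zclosureS Y Z : (forall v, Y v -> Z v) -> forall v, zclosure Y v -> zclosure Z v.
Proof. by move=> YZ v cv f fZ; apply: cv => u /YZ; apply: fZ. Qed.

Lemma zclosedU Y Z : zclosed Y -> zclosed Z -> zclosed (fun v => Y v \/ Z v).
Proof.
case=> S SP [T TP]; exists (fun h => exists f g, [/\ S f, T g & h = f * g]) => v.
split=> [[/SP H|/TP H] _ [f [g [Sf Tg ->]]]|H].
- by rewrite polyfunM H // mul0r.
- by rewrite polyfunM (H g) // mulr0.
have [?|nS] := pselect (Y v); [by left|right]; apply/TP => g Tg.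
have [f Sf fv] : exists2 f, S f & polyfun f v != 0.
  apply: contrapT => H'; apply: nS; apply/SP => f Sf; apply: contrapT => /eqP fv.
  by apply: H'; exists f.
have /eqP := H (f * g) (ex_intro _ f (ex_intro _ g (And3 Sf Tg erefl))).
by rewrite polyfunM mulf_eq0 (negPf fv) => /eqP.
Qed.

(** Points are closed. *)
Lemma zclosed_vector (w : V) : zclosed (fun v => v = w).
Proof.
exists (fun f => exists i, f = 'X_i - (coord (vbasis {:V}) i w)%:MP) => v.
split=> [-> _ [i ->]|H]; first by rewrite /polyfun mevalB mevalXU mevalC subrr.
rewrite (coord_vbasis (memvf v)) (coord_vbasis (memvf w)); apply: eq_bigr => i _.
congr (_ *: _); apply/eqP; rewrite -subr_eq0; apply/eqP.
by rewrite -(H _ (ex_intro _ i erefl)) /polyfun mevalB mevalXU mevalC.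
Qed.

Lemma zclosed_linear (l : {scalar V}) : zclosed (fun v : V => l v = 0).
Proof.
have [f fE] : exists f, forall v, polyfun f v = l v.
  exists (\sum_(i < D) l (vbasis {:V})`_i *: 'X_i) => v.
  rewrite /polyfun raddf_sum /= {2}(coord_vbasis (memvf v)) raddf_sum.
  by apply: eq_bigr => i _; rewrite mevalZ mevalXU [RHS](linearZ_LR l) mulrC.
have [S SP] := zclosed_polyfun f; exists S => v; rewrite -fE; exact: SP.
Qed.

End KrullDimension.

(** * Polynomial families, curves and chains *)

Section Families.
Variables (K : fieldType) (M : nat).

(** Families of vectors of W, possibly of infinite dimension, that depend
    polynomially on a point of K^M: finite combinations of fixed vectors with
    polynomial coefficients. *)
Definition poly_family (W : lmodType K) (psi : ('I_M -> K) -> W) :=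
  exists (T : finType) (h : T -> {mpoly K[M]}) (w : T -> W),
    forall a, psi a = \sum_t (h t).@[a] *: w t.

Lemma poly_family_cst (W : lmodType K) (w : W) : poly_family (fun=> w).
Proof.
by exists 'I_1, (fun=> 1), (fun=> w) => a; rewrite big_ord1 meval1 scale1r.
Qed.

Lemma poly_family_scale (W : lmodType K) (h : {mpoly K[M]}) (w : W) :
  poly_family (fun a => h.@[a] *: w).
Proof. by exists 'I_1, (fun=> h), (fun=> w) => a; rewrite big_ord1. Qed.

Lemma poly_familyD (W : lmodType K) (psi psi' : ('I_M -> K) -> W) :
  poly_family psi -> poly_family psi' -> poly_family (fun a => psi a + psi' a).
Proof.
case=> T [h [w E]] [T' [h' [w' E']]].
exists (T + T')%type, (fun t => match t with inl x => h x | inr x => h' x end),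
  (fun t => match t with inl x => w x | inr x => w' x end) => a.
by rewrite big_sumType /= E E'.
Qed.

Lemma poly_family_sum (W : lmodType K) (I : finType) (psi : I -> ('I_M -> K) -> W) :
  (forall i, poly_family (psi i)) -> poly_family (fun a => \sum_i psi i a).
Proof.
move=> H; elim: (index_enum I) => [|i r IH].
  have [T [h [w E]]] := poly_family_cst (0 : W).
  by exists T, h, w => a; rewrite big_nil.
have [T [h [w E]]] := poly_familyD (H i) IH.
by exists T, h, w => a; rewrite big_cons E.
Qed.

Lemma poly_family_prod (A : comAlgType K) (I : finType) (psi : I -> ('I_M -> K) -> A) :
  (forall i, poly_family (psi i)) -> poly_family (fun a => \prod_i psi i a).
Proof.
move=> H; elim: (index_enum I) => [|i r [T' [h' [w' E']]]].
  have [T [h [w E]]] := poly_family_cst (1 : A).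
  by exists T, h, w => a; rewrite big_nil.
have [T [h [w E]]] := H i.
exists (T * T')%type, (fun t => h t.1 * h' t.2), (fun t => w t.1 * w' t.2) => a.
rewrite big_cons E E' big_distrlr /= pair_big /=; apply: eq_bigr => -[t t'] _ /=.
by rewrite mevalM -scalerAl -scalerAr scalerA.
Qed.

Lemma poly_family_linear (W W' : lmodType K) (f : {linear W -> W'}) psi :
  poly_family psi -> poly_family (fun a => f (psi a)).
Proof.
case=> T [h [w E]]; exists T, h, (fun t => f (w t)) => a.
by rewrite E linear_sum; apply: eq_bigr => t _; rewrite linearZ.
Qed.

Lemma poly_family_map (V : vectType K) (psi : ('I_M -> K) -> V) :
  poly_family psi -> polynomial_map psi.
Proof.
case=> T [h [w E]] i; exists (\sum_t coord (vbasis {:V}) i (w t) *: h t) => a.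
rewrite E linear_sum [RHS](raddf_sum (meval a)) /=; apply: eq_bigr => t _.
by rewrite linearZ mevalZ mulrC.
Qed.

End Families.

Section Irreducible.
Variables (K : closedFieldType) (V : vectType K).
Implicit Types (X Y : V -> Prop).

(** A nonempty set any two points of which lie on a polynomial curve inside
    the set is irreducible. *)
Lemma zirreducible_curves Y :
  (exists v, Y v) ->
  (forall u v, Y u -> Y v -> exists phi : ('I_1 -> K) -> V,
     [/\ polynomial_map phi, forall a, Y (phi a), exists a, phi a = u & exists a, phi a = v]) ->
  zirreducible Y.
Proof.
move=> Y0 curve; split=> // Y1 Y2 [S1 SP1] [S2 SP2] cov.
have [?|n1] := pselect (forall v, Y v -> Y1 v); [by left|right => v Yv].
apply/SP2 => f2 Sf2; apply: contrapT => /eqP f2v; apply: n1 => u Yu.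
apply/SP1 => f1 Sf1; apply: contrapT => /eqP f1u.
have [phi [pphi Yphi [a ua] [b vb]]] := curve u v Yu Yv.
have [h1 E1] := polynomial_mapE f1 pphi; have [h2 E2] := polynomial_mapE f2 pphi.
have h10 : h1 != 0 by apply: contraNneq f1u => Z; rewrite -ua E1 Z meval0.
have h20 : h2 != 0 by apply: contraNneq f2v => Z; rewrite -vb E2 Z meval0.
have [c] := mpoly_nonzero_point (mulf_neq0 h10 h20).
rewrite mevalM -E1 -E2; case: (cov _ (Yphi c)) => [/SP1 H|/SP2 H].
  by rewrite (H f1) // mul0r eqxx.
by rewrite (H f2) // mulr0 eqxx.
Qed.

(** A chain can be extended by a larger irreducible closed set. *)
Lemma zchain_extend X n (Z : nat -> V -> Prop) Y :
  zchain X n Z -> zclosed_in X Y -> zirreducible Y ->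
  (forall v, Z n v -> Y v) -> (exists2 v, Y v & ~ Z n v) ->
  exists2 Z', zchain X n.+1 Z' & Z' n.+1 = Y.
Proof.
move=> [cl st] clY irrY sub str.
exists (fun i => if (i <= n)%N then Z i else Y); last by rewrite ltnn.
split=> i; rewrite ?ltnS => lein; first by case: leqP => // /cl.
by rewrite lein; case: ltngtP lein => // [/st|->].
Qed.

End Irreducible.

(** * Products on the surface *)

Section Surface.
Variables (R : realType) (l : nat).
Local Notation C := R[i].
Variable (Q : dhomog 3 C l).
Variable ip : forall k : nat, {dot (dhomog 3 C k) for Num.conj}.
Local Notation V := (VQperp Q ip).
Local Notation q := (mpoly_of_dhomog Q).

Lemma poly_of_is_linear d : linear (@poly_of R l Q ip d).
Proof. by []. Qed.
HB.instance Definition _ d := GRing.isLinear.Build C (V d) {mpoly C[3]} *:%R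
  (@poly_of R l Q ip d) (@poly_of_is_linear d).

Lemma poly_of_homog d (p : V d) : poly_of p \is d.-homog.
Proof. exact: dhomog_is_dhomog. Qed.

(** The class modulo Q of the homogeneous part of degree d. Unlike [indhomog],
    which is 0 on polynomials that are not homogeneous, it is linear. *)
Definition reduce d (p : {mpoly C[3]}) : V d :=
  vsproj (VQorth Q ip d) (daddv_pi (VQorth Q ip d) (VQ Q d) (indhomog d (pihomog mdeg d p))).

Lemma reduce_is_linear d : linear (reduce d).
Proof.
have lin a (u v : {mpoly C[3]}) : indhomog d (pihomog mdeg d (a *: u + v)) =
    a *: indhomog d (pihomog mdeg d u) + indhomog d (pihomog mdeg d v).
  apply: val_inj; rewrite /= !indhomogK ?pihomogP //.
  by rewrite raddfD /= linearZ.
by move=> a u v; rewrite /reduce lin !linearP.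
Qed.
HB.instance Definition _ d := GRing.isLinear.Build C {mpoly C[3]} (V d) *:%R
  (reduce d) (@reduce_is_linear d).

Lemma prod_homog s (omega : 'I_s -> nat) (P : forall i, V (omega i)) :
  \prod_i poly_of (P i) \is (\sum_i omega i)%N.-homog.
Proof.
elim/big_rec2: _ => [|i e p _ hp]; first exact: dhomog1.
by apply: dhomogM => //; apply: poly_of_homog.
Qed.

Section Products.
Variables (s d : nat) (omega : 'I_s -> nat).
Hypothesis dE : d = (\sum_i omega i)%N.

Lemma prod_perpE (P : forall i, V (omega i)) :
  prod_perp d P = reduce d (\prod_i poly_of (P i)).
Proof.
rewrite /prod_perp /reduce; congr (vsproj _ (daddv_pi _ _ _)).
by rewrite pihomog_dE // dE; apply: prod_homog.
Qed.

Lemma prod_perp_scale (lam : 'I_s -> C) (P : forall i, V (omega i)) :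
  prod_perp d (fun i => lam i *: P i) = (\prod_i lam i) *: prod_perp d P.
Proof.
rewrite !prod_perpE -linearZ; congr (reduce _ _).
by rewrite -scaler_prod; apply: eq_bigr => i _; rewrite linearZ.
Qed.

Lemma prod_perp_eq (P P' : forall i, V (omega i)) :
  (forall i, P i = P' i) -> prod_perp d P = prod_perp d P'.
Proof.
by move=> E; rewrite !prod_perpE; congr (reduce _ _); apply: eq_bigr => i _; rewrite E.
Qed.

Lemma prod_perp_family M (P : ('I_M -> C) -> forall i, V (omega i)) :
  (forall i, poly_family (fun a => P a i)) ->
  poly_family (fun a => prod_perp d (P a)).
Proof.
move=> H; have [T [h [w E]]] : poly_family (fun a => reduce d (\prod_i poly_of (P a i))).
  apply: poly_family_linear; apply: poly_family_prod => i.
  exact: poly_family_linear.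
by exists T, h, w => a; rewrite prod_perpE.
Qed.

(** The products of factors taken from given subspaces. *)
Definition products (L : forall i, {vspace V (omega i)}) (W : V d) :=
  exists2 P : forall i, V (omega i), (forall i, P i \in L i) & W = prod_perp d P.

(** Two products are joined by the curve of products of P_i + a (P'_i - P_i). *)
Lemma zirreducible_products L : zirreducible (products L).
Proof.
apply: zirreducible_curves.
  by exists (prod_perp (omega := omega) d (fun i => 0)), (fun i => 0) => // i; rewrite mem0v.
move=> _ _ [P PL ->] [P' PL' ->].
exists (fun a => prod_perp (omega := omega) d (fun i => P i + a 0 *: (P' i - P i))); split.
- apply: poly_family_map; apply: prod_perp_family => i; apply: poly_familyD.
    exact: poly_family_cst.
  have [T [h [w E]]] := poly_family_scale ('X_0 : {mpoly C[1]}) (P' i - P i).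
  by exists T, h, w => a; rewrite -E mevalXU.
- by move=> a; exists (fun i => P i + a 0 *: (P' i - P i)) => // i; rewrite memvD ?memvZ ?memvB.
- by exists (fun=> 0); apply: prod_perp_eq => i; rewrite scale0r addr0.
- by exists (fun=> 1); apply: prod_perp_eq => i; rewrite scale1r addrC subrK.
Qed.

(** The products of nonzero factors. *)
Definition nonzero_products (W : V d) :=
  exists2 P : forall i, V (omega i), (forall i, P i != 0) & W = prod_perp d P.

(** The image of Phi is the set of products of nonzero factors. *)
Lemma PhiP W :
  (exists m : moduli Q ip omega, Phi d m = W) <-> nonzero_products W.
Proof.
split=> [[m <-]|[P P0 ->]]; last by exists (moduli_class (Factors P0)); rewrite PhiE.
rewrite /Phi; case: cid => /= P _.
by exists P => // i; apply: factor_neq0.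
Qed.

End Products.

Lemma dim_forms d : \dim {: dhomog 3 C d} = 'C(d + 2, d).
Proof. by rewrite dimvf. Qed.

Lemma dim_VQ d : (l <= d)%N -> q != 0 -> \dim (VQ Q d) = 'C(d - l + 2, d - l).
Proof.
move=> ld q0; have lin : linear (@mulQ R l Q d).
  by move=> a u v; apply: val_inj; rewrite /= !mulQE //= mulrDr scalerAr.
pose Lm := GRing.isLinear.Build _ _ _ _ _ lin.
pose f : {linear dhomog 3 C (d - l) -> dhomog 3 C d} := HB.pack (@mulQ R l Q d) Lm.
have E r : linfun (@mulQ R l Q d) r = mulQ Q r.
  by rewrite -[RHS]/(f r) -[LHS]/(linfun f r) lfunE.
rewrite /VQ ld limg_dim_eq ?dim_forms //.
apply/eqP; rewrite -subv0; apply/subvP => r; rewrite memv_cap memv_ker E memv0.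
move=> /andP[_ /eqP/(congr1 val)]; rewrite /= mulQE // => /eqP.
by rewrite mulf_eq0 (negPf q0) => /eqP r0; apply/eqP/val_inj.
Qed.

Lemma dim_VQperp d : \dim {: V d} = \dim (VQorth Q ip d).
Proof. by rewrite dimvf. Qed.

(** dim V_Q^perp(d) = l d + 1 - g, with g = (l-1)(l-2)/2 the arithmetic genus of
    the plane curve Q = 0. *)
Lemma dim_VQperp_genus d : (0 < l <= d)%N -> q != 0 ->
  (\dim {: V d} + 'C(l.-1, 2) = l * d + 1)%N.
Proof.
move=> /andP[l0 ld] q0.
have := dimv_disjoint_sum (VQ_orth_direct Q ip d).
rewrite VQ_orth_full dim_forms dim_VQ // -dim_VQperp.
rewrite -!(bin_sub (leq_addr _ _)) !addKn.
have bin2' k : ('C(k + 2, 2) * 2 = (k + 2) * (k + 1))%N.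
  by rewrite mulnC -mul_bin_diag bin1 addn1 addn2.
have bin2g : ('C(l.-1, 2) * 2 = l.-1 * l.-2)%N.
  by rewrite mulnC -mul_bin_diag bin1.
have := bin2' d; have := bin2' (d - l)%N.
move: ('C(d + 2, 2)) ('C(d - l + 2, 2)) ('C(l.-1, 2)) (\dim {:V d}) bin2g => A B G N.
case: l l0 ld => // k _ /subnKC; move: (d - k.+1)%N => e <-.
case: k => [|k] /=; nia.
Qed.

End Surface.

(** * Charts and chains of products *)

(** Multiplication by a k-homogeneous polynomial shifts homogeneous components. *)
Lemma pihomogM_homog n (A : nzRingType) (p r : {mpoly A[n]}) k d :
  p \is k.-homog -> (k <= d)%N ->
  pihomog mdeg d (p * r) = p * pihomog mdeg (d - k) r.
Proof.
move=> hp kd; rewrite [r]mpolyE mulr_sumr !raddf_sum mulr_sumr /=.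
apply: eq_bigr => m _.
have hX : (r@_m *: 'X_[m] : {mpoly A[n]}) \is (mdeg m).-homog.
  by apply: dhomogZ; rewrite dhomogX.
have := dhomogM hp hX; have [E|ne] := eqVneq (mdeg m) (d - k)%N.
  rewrite E subnKC // => hM; rewrite !pihomog_dE //.
  by rewrite -E.
move=> hM; rewrite (pihomog_ne0 (d := (k + mdeg m)%N)) //.
  by rewrite (pihomog_ne0 (d := mdeg m)) ?mulr0 // eq_sym.
by apply: contra_neq ne => <-; rewrite addKn.
Qed.

Lemma prime_divides_prod (A : idomainType) (p : A) (I : finType) (F : I -> A) :
  prime_elt p -> divides p (\prod_i F i) -> exists i, divides p (F i).
Proof.
case=> p0 pU pP; elim: (index_enum I) => [|i r IH].
  by rewrite big_nil => -[c E]; case/negP: pU; apply/unitrP; exists c; rewrite mulrC -E.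
by rewrite big_cons => /pP[|/IH//]; exists i.
Qed.

Section Dimension.
Variables (R : realType) (l : nat).
Local Notation C := R[i].
Variable (Q : dhomog 3 C l).
Variable ip : forall k : nat, {dot (dhomog 3 C k) for Num.conj}.
Local Notation V := (VQperp Q ip).
Local Notation q := (mpoly_of_dhomog Q).
Hypothesis irrQ : irreducible_mpoly q.

Let primeQ : prime_elt q := irreducible_prime irrQ.

(** Nonzero elements of V_Q^perp(d) are not divisible by Q, even with a cofactor
    that is not homogeneous. *)
Lemma divides_poly_of d (p : V d) : (l <= d)%N -> divides q (poly_of p) -> p = 0.
Proof.
move=> ld [r E]; apply: val_inj => /=.
have pV : vsval p \in VQ Q d.
  apply/mem_VQP; rewrite ld; exists (indhomog (d - l) (pihomog mdeg (d - l) r)).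
  rewrite indhomogK ?pihomogP // -pihomogM_homog ?dhomog_is_dhomog // -E.
  by rewrite pihomog_dE // poly_of_homog.
by apply/eqP; rewrite -memv0 -(VQ_orth_direct Q ip d) memv_cap subvsP.
Qed.

Section Products.
Variables (s d : nat) (omega : 'I_s -> nat).
Hypothesis dE : d = (\sum_i omega i)%N.
Hypothesis omega_ge : forall i, (l <= omega i)%N.

Lemma not_divides_prod (P : forall i, V (omega i)) :
  (forall i, P i != 0) -> ~ divides q (\prod_i poly_of (P i)).
Proof.
move=> P0 /(prime_divides_prod primeQ)[i /(divides_poly_of (omega_ge i)) E].
by move: (P0 i); rewrite E eqxx.
Qed.

Lemma prod_perp_neq0 (P : forall i, V (omega i)) :
  (forall i, P i != 0) -> prod_perp d P != 0.
Proof.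
move=> P0; apply/eqP => E; apply: (not_divides_prod P0).
have [r rE] := prod_perpP P dE; exists r.
by rewrite -rE E (linear0 (@poly_of R l Q ip d)) subr0.
Qed.

(** On the surface, the values of a product are the products of the values. *)
Lemma prod_perp_eval (P : forall i, V (omega i)) v : q.@[v] = 0 ->
  (poly_of (prod_perp d P)).@[v] = \prod_i (poly_of (P i)).@[v].
Proof.
move=> qv; have [r rE] := prod_perpP P dE.
have /(congr1 (meval v)) := rE; rewrite mevalB mevalM qv mul0r => /eqP.
by rewrite subr_eq0 => /eqP <-; rewrite rmorph_prod.
Qed.

Local Notation n i := (\dim {: V (omega i)}).

(** The parameters of a chart: the common scalar [None], and n_i - 1 affine
    coordinates for each factor. *)
Definition affine_index := option {i : 'I_s & 'I_(n i).-1}.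

Lemma card_affine_index : #|{: affine_index}| = (\sum_i (n i).-1).+1.
Proof.
rewrite card_option card_tagged sumnE big_map big_enum /=.
by congr _.+1; apply: eq_bigr => i _; rewrite card_ord.
Qed.

(** A nonzero factor P_i is a scalar multiple of a point of one of the affine
    charts b_j + span(b_k, k <> j) of its space; collecting the scalars leaves a
    single homogeneous parameter. *)
Definition chart_factor (j : forall i, 'I_(n i)) (a : 'I_#|{: affine_index}| -> C)
    i : V (omega i) :=
  (vbasis {: V (omega i)})`_(j i) +
  \sum_(k < (n i).-1) a (enum_rank (Some (Tagged (fun i => 'I_(n i).-1) k) : affine_index)) *:
     (vbasis {: V (omega i)})`_(lift (j i) k).

(** The product of the chart points, times the common scalar. *)
Definition chart j a : V d :=
  a (enum_rank (None : affine_index)) *: prod_perp d (chart_factor j a).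

Lemma chart_polynomial j : polynomial_map (chart j).
Proof.
apply: poly_family_map.
have [T [h [w E]]] : poly_family (fun a => prod_perp d (chart_factor j a)).
  apply: prod_perp_family => // i; apply: poly_familyD.
    exact: poly_family_cst.
  apply: poly_family_sum => k.
  set x := enum_rank _; set u := _`__.
  have [T [h [w E]]] := poly_family_scale ('X_x : {mpoly C[_]}) u.
  by exists T, h, w => a; rewrite -E mevalXU.
exists T, (fun t => 'X_(enum_rank (None : affine_index)) * h t), w => a.
rewrite /chart E scaler_sumr; apply: eq_bigr => t _.
by rewrite scalerA mevalM mevalXU.
Qed.

Lemma products_cover : (forall i, 0 < n i)%N ->
  param_cover (\sum_i (n i).-1).+1
    (fun W : V d => exists P : forall i, V (omega i), W = prod_perp d P).
Proof.
move=> n0; rewrite -card_affine_index.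
exists {dffun forall i : 'I_s, 'I_(n i)},
  (fun j : {dffun forall i : 'I_s, 'I_(n i)} => chart (fun i => j i)); split=> [j|_ [P ->]].
  exact: chart_polynomial.
have [[i /eqP Pi0]|nz] := pselect (exists i, P i == 0).
  (* The zero product is reached with scalar 0 in any chart. *)
  exists [ffun i => Ordinal (n0 i)], (fun=> 0).
  rewrite /chart scale0r prod_perpE // (bigD1 i) //= Pi0.
  by rewrite (linear0 (@poly_of R l Q ip _)) mul0r linear0.
have [j jP] : exists j : forall i, 'I_(n i), forall i,
    coord (vbasis {: V (omega i)}) (j i) (P i) != 0.
  apply: (@fin_all_exists _ _ (fun i k => coord (vbasis {: V (omega i)}) k (P i) != 0)) => i.
  apply: contrapT => H; apply: nz; exists i; apply/eqP.
  rewrite (coord_vbasis (memvf (P i))) big1 // => k _.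
  have [->|k0] := eqVneq (coord (vbasis {: V (omega i)}) k (P i)) 0; first by rewrite scale0r.
  by case: H; exists k.
pose lam i := coord (vbasis {: V (omega i)}) (j i) (P i).
pose a (x : 'I_#|{: affine_index}|) := match enum_val x with
  | None => \prod_i lam i
  | Some u => coord (vbasis {: V (omega (tag u))}) (lift (j (tag u)) (tagged u)) (P (tag u)) / lam (tag u)
  end.
exists (finfun j), a; rewrite /chart {1}/a enum_rankK /= -prod_perp_scale //.
apply: prod_perp_eq => // i; rewrite /chart_factor ffunE.
rewrite {1}(coord_vbasis (memvf (P i))) (bigD1_ord (j i)) //= scalerDr; congr (_ + _).
rewrite scaler_sumr; apply: eq_bigr => k _.
by rewrite scalerA /a enum_rankK /= [X in _ = X *: _]mulrC divfK ?jP.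
Qed.

Local Notation X := (@nonzero_products R l Q ip s d omega).
Local Notation prods := (@products R l Q ip s d omega).

Lemma products_nonzero (L : forall i, {vspace V (omega i)}) (W : V d) : prods L W -> W != 0 -> X W.
Proof.
case=> P _ -> W0; exists P => // i; apply: contra_neq W0 => Pi0.
rewrite prod_perpE // (bigD1 i) //= Pi0.
by rewrite (linear0 (@poly_of R l Q ip _)) mul0r linear0.
Qed.

(** Nonzero subspaces contain nonzero factors. *)
Lemma nonzero_family (L : forall i, {vspace V (omega i)}) : (forall i, L i != 0%VS) ->
  exists2 P : forall i, V (omega i), (forall i, P i \in L i) & (forall i, P i != 0).
Proof.
move=> L0; exists (fun i => vpick (L i)) => i; first exact: memv_pick.
by rewrite vpick0.
Qed.

(** The trace on X of the closure of the products with factors in the L_i. *)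
Definition closed_products (L : forall i, {vspace V (omega i)}) (W : V d) :=
  X W /\ zclosure (prods L) W.

Lemma closed_products_closed L : zclosed_in X (closed_products L).
Proof. by exists (zclosure (prods L)) => //; apply: zclosed_zclosure. Qed.

(** Discarding the zero product does not affect irreducibility. *)
Lemma closed_products_irreducible L :
  (forall i, L i != 0%VS) -> zirreducible (closed_products L).
Proof.
move=> /nonzero_family[P PL P0]; have Pw : prods L (prod_perp d P) by exists P.
split; first by exists (prod_perp d P); split; [exists P|apply: sub_zclosure].
move=> Y1 Y2 cl1 cl2 cov; have [_ irr] := zirreducible_products dE L.
have cl0 := @zclosed_vector _ (V d) 0.
have [|H|H] := irr _ _ (zclosedU cl1 cl0) cl2.
- move=> W LW; have [->|W0] := eqVneq W 0; first by left; right.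
  by case: (cov W); [split; [exact: products_nonzero LW W0|exact: sub_zclosure]|left; left|right].
- have [//|H'|H'] := irr _ _ cl1 cl0.
    by left => W [_]; apply: zclosure_min.
  by have := prod_perp_neq0 P0; rewrite (H' _ Pw) eqxx.
- by right => W [_]; apply: zclosure_min.
Qed.

(** Evaluation at a point of C^3, with values in C as a vector space over
    itself. *)
Definition eval_at k (v : 'I_3 -> C) (p : V k) : C^o := (poly_of p).@[v].

Lemma eval_at_is_linear k v : linear (@eval_at k v).
Proof. by move=> a p p'; rewrite /eval_at (linearP (@poly_of R l Q ip k)) mevalD mevalZ. Qed.
HB.instance Definition _ k v := GRing.isLinear.Build C (V k) C^o *:%R
  (@eval_at k v) (@eval_at_is_linear k v).

Lemma eval_at_is_scalar k v : scalar (@eval_at k v).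
Proof. exact: eval_at_is_linear. Qed.

Lemma zclosed_eval v : zclosed (fun W : V d => (poly_of W).@[v] = 0).
Proof.
pose f : {scalar V d} := HB.pack (@eval_at d v)
  (GRing.isLinear.Build C (V d) C *%R (@eval_at d v) (@eval_at_is_scalar d v)).
exact: (@zclosed_linear _ (V d) f).
Qed.

(** Vanishing at a point v is one condition on U, unless U vanishes at v. *)
Lemma dim_eval_kernel k (U : {vspace V k}) v p : p \in U -> (poly_of p).@[v] != 0 ->
  \dim (U :&: lker (linfun (@eval_at k v))) = (\dim U).-1.
Proof.
move=> pU pv; set f := linfun _; rewrite -(limg_ker_dim f U).
suff -> : \dim (f @: U) = 1%N by rewrite addn1.
apply/eqP; rewrite eqn_leq; apply/andP; split.
  by rewrite (leq_trans (dimvS (subvf _))) // dimvf.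
rewrite lt0n dimv_eq0; apply: contraNneq pv => fU0.
have : f p \in (f @: U)%VS by apply: memv_img.
by rewrite fU0 memv0 lfunE /= /eval_at.
Qed.

(** The chain for the L_i: cut one L_i of dimension at least 2 by the hyperplane of
    polynomials vanishing at a well-chosen point v of the surface; when all L_i
    are lines, add a single point at the bottom. *)
Lemma products_chain N L : (0 < s)%N -> (forall i, L i != 0%VS) ->
  (\sum_i (\dim (L i)).-1)%N = N ->
  exists2 Z, zchain X N.+1 Z & Z N.+1 = closed_products L.
Proof.
move=> s0; elim: N L => [|N IH] L L0 sumL; have [P PL P0] := nonzero_family L0.
  set w := prod_perp d P; have w0 : w != 0 by apply: prod_perp_neq0.
  have Xw : X w by exists P.
  apply: (@zchain_extend _ _ _ _ (fun=> fun W => W = w)).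
  - split=> // i _; split.
      exists (fun W => W = w); first exact: zclosed_vector.
      by move=> W; split=> [->|[]].
    split; first by exists w.
    by move=> Y1 Y2 _ _ /(_ w erefl)[Yw|Yw]; [left|right] => _ ->.
  - exact: closed_products_closed.
  - exact: closed_products_irreducible.
  - by move=> _ ->; split=> //; apply: sub_zclosure; exists P.
  (* Doubling one factor doubles the product and moves it off the point w. *)
  pose lam (i : 'I_s) : C := if i == Ordinal s0 then 2 else 1.
  have prodlam : \prod_i lam i = 2.
    rewrite (bigD1 (Ordinal s0)) //= {1}/lam eqxx big1 ?mulr1 // => i ne.
    by rewrite /lam (negPf ne).
  have lam0 i : lam i != 0 by rewrite /lam; case: ifP; rewrite ?oner_eq0 ?pnatr_eq0.
  exists (prod_perp d (fun i => lam i *: P i)).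
    split; first by exists (fun i => lam i *: P i) => // i; rewrite scaler_eq0 negb_or lam0 P0.
    by apply: sub_zclosure; exists (fun i => lam i *: P i) => // i; rewrite memvZ.
  rewrite prod_perp_scale // prodlam -/w => /eqP.
  by rewrite scaler_nat mulr2n -subr_eq0 addrK (negPf w0).
have [i0 dim0] : exists i0, (0 < (\dim (L i0)).-1)%N.
  apply: contrapT => H; move: sumL; rewrite big1 // => i _.
  by apply/eqP; rewrite -leqn0 leqNgt; apply/negP => ?; apply: H; exists i.
(* v is a point of the surface at which no P_i vanishes. *)
have [v [qv Pv]] := prime_zero_point primeQ (not_divides_prod P0).
rewrite rmorph_prod in Pv.
have Pvi i : (poly_of (P i)).@[v] != 0 by move/prodf_neq0: Pv; apply.
pose L' i := (if i == i0 then L i :&: lker (linfun (@eval_at (omega i) v)) else L i)%VS.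
have dimL' : \dim (L' i0) = (\dim (L i0)).-1.
  by rewrite /L' eqxx (dim_eval_kernel (PL i0) (Pvi i0)).
have L'L i : (L' i <= L i)%VS by rewrite /L'; case: ifP => _; rewrite ?capvSl.
have [||Z chZ ZN] := IH L'.
- move=> i; have [->|ne] := eqVneq i i0; first by rewrite -dimv_eq0 dimL' -lt0n.
  by rewrite /L' (negPf ne).
- apply/eqP; rewrite -eqSS -[X in _ == X]sumL (bigD1 i0) //= [X in _ == X](bigD1 i0) //=.
  rewrite dimL' -addSn prednK //; apply/eqP; congr (_ + _)%N.
  by apply: eq_bigr => i ne; rewrite /L' (negPf ne).
have sub W : prods L' W -> prods L W.
  by case=> P' PL' ->; exists P' => // i; apply: (subvP (L'L i)).
apply: (zchain_extend chZ).
- exact: closed_products_closed.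
- exact: closed_products_irreducible.
- by rewrite ZN => W [XW cW]; split=> //; apply: zclosureS cW.
(* The product of the P_i is nonzero at v, where the smaller set vanishes. *)
exists (prod_perp d P).
  by split; [exists P|apply: sub_zclosure; exists P].
rewrite ZN => -[_ /(zclosure_min (zclosed_eval v)) H].
move/negP: Pv; apply; apply/eqP; rewrite -prod_perp_eval //; apply: H.
move=> _ [P' PL' ->]; rewrite prod_perp_eval // (bigD1 i0) //=.
have := PL' i0; rewrite /L' eqxx memv_cap memv_ker lfunE => /andP[_ /eqP].
by rewrite /= /eval_at => ->; rewrite mul0r.
Qed.

End Products.
End Dimension.

(** * Codimension and genericity *)

(** A nonzero polynomial is a nonzero function on V. *)
Lemma polyfun_nonzero_point (K : closedFieldType) (V : vectType K)
  (f : {mpoly K[\dim {:V}]}) : f != 0 -> exists v, polyfun f v != 0.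
Proof.
move=> /mpoly_nonzero_point[a fa]; exists (\sum_i a i *: (vbasis {:V})`_i).
apply: contraNneq fa => <-; apply/eqP/meval_eq => i.
by rewrite coord_sum_free // (basis_free (vbasisP _)).
Qed.

Section Codimension.
Variables (R : realType) (l : nat).
Local Notation C := R[i].
Variable (Q : dhomog 3 C l).
Variable ip : forall k : nat, {dot (dhomog 3 C k) for Num.conj}.
Local Notation V := (VQperp Q ip).
Local Notation q := (mpoly_of_dhomog Q).
Hypotheses (l_gt2 : (2 < l)%N) (irrQ : irreducible_mpoly q).

Let q_neq0 : q != 0. Proof. by case: irrQ. Qed.

Lemma dim_VQperp_gt0 d : (l <= d)%N -> (0 < \dim {: V d})%N.
Proof.
move=> ld; have := @dim_VQperp_genus R l Q ip d; rewrite (ltnW (ltnW l_gt2)) ld => /(_ isT q_neq0).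
have : ('C(l.-1, 2) * 2 = l.-1 * l.-2)%N by rewrite mulnC -mul_bin_diag bin1.
by move: ('C(_, _)) (\dim _) => g n; nia.
Qed.

(** The expected codimension (s-1) g of the products. *)
Lemma dim_count s d (omega : 'I_s -> nat) :
  (0 < s)%N -> (forall i, (l <= omega i)%N) -> d = (\sum_i omega i)%N ->
  ((\sum_i (\dim {: V (omega i)}).-1).+1 + s.-1 * 'C(l.-1, 2) = \dim {: V d})%N.
Proof.
move=> s0 omega_ge dE; have l0 : (0 < l)%N by apply: ltnW (ltnW l_gt2).
have ld : (l <= d)%N.
  by rewrite dE (bigD1 (Ordinal s0)) //= (leq_trans (omega_ge (Ordinal s0))) ?leq_addr.
have := @dim_VQperp_genus R l Q ip d; rewrite l0 ld => /(_ isT q_neq0).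
have : (\sum_i ((\dim {: V (omega i)}).-1 + 'C(l.-1, 2)) = l * d)%N.
  rewrite dE big_distrr; apply: eq_bigr => i _ /=; apply: succn_inj.
  rewrite -addSn prednK ?dim_VQperp_gt0 // dim_VQperp_genus ?l0 ?omega_ge //.
  by rewrite addn1.
rewrite big_split /= sum_nat_const card_ord.
move: (\sum_i _)%N (\dim _) 'C(_, _) (l * d)%N => A D g ld'.
by case: s s0 {omega omega_ge dE} => // k _ /=; rewrite mulSn; lia.
Qed.

(** For s > 1 the products satisfy a nontrivial polynomial equation. *)
Lemma products_vanish s d (omega : 'I_s -> nat) :
  (1 < s)%N -> (forall i, (l <= omega i)%N) -> d = (\sum_i omega i)%N ->
  exists2 f : {mpoly C[\dim {: V d}]}, f != 0 &
    forall P : forall i, V (omega i), polyfun f (prod_perp d P) = 0.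
Proof.
move=> s1 omega_ge dE.
have cov := products_cover (Q := Q) (ip := ip) dE (fun i => dim_VQperp_gt0 (omega_ge i)).
have [|f f0 fP] := param_cover_vanishing cov.
  rewrite -(dim_count (ltnW s1) omega_ge dE) -[X in (X < _)%N]addn0 ltn_add2l muln_gt0 bin_gt0.
  by apply/andP; split; lia.
by exists f => // P; apply: fP; exists P.
Qed.

Lemma generic_not_product s d (omega : 'I_s -> nat) :
  (1 < s)%N -> (forall i, (l <= omega i)%N) -> d = (\sum_i omega i)%N ->
  zgeneric (fun W : V d => W != 0 /\ ~ product_of_degrees_ge W).
Proof.
move=> s1 omega_ge dE.
pose vanish (f : {mpoly C[\dim {: V d}]}) k (e : 'I_k -> nat) :=
  forall P : forall i, V (e i), polyfun f (prod_perp d P) = 0.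
pose valid k (e : 'I_k -> nat) :=
  [/\ (1 < k)%N, forall i, (l <= e i)%N & d = (\sum_i e i)%N].
(* Each part is at least l > 0, so both the number of parts and the parts are at
   most d: only finitely many families of degrees occur. *)
pose T := {k : 'I_d.+1 & {ffun 'I_k -> 'I_d.+1}}.
have /fin_all_exists[f fP] (t : T) : exists f : {mpoly C[\dim {: V d}]}, f != 0 /\
    (valid (tag t) (fun i => tagged t i) -> vanish f (tag t) (fun i => tagged t i)).
  have [[k1 el eE]|nv] := pselect (valid (tag t) (fun i => tagged t i)).
    by have [f f0 fP] := products_vanish k1 el eE; exists f.
  by exists 1; rewrite oner_neq0.
pose F := \prod_t f t.
have FP W : polyfun F W != 0 -> ~ product_of_degrees_ge W.
  move=> FW [k [e [P [k1 el eE PW]]]].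
  have ed i : (e i <= d)%N by rewrite -eE (bigD1 i) //= leq_addr.
  have kd : (k < d.+1)%N.
    rewrite ltnS -eE -[X in (X <= _)%N]card_ord -sum1_card leq_sum // => i _.
    by rewrite (leq_trans _ (el i)) // ltnW // ltnW.
  pose t : T := Tagged (fun k : 'I_d.+1 => {ffun 'I_k -> 'I_d.+1})
    ([ffun i => inord (e i)] : {ffun 'I_(Ordinal kd) -> 'I_d.+1}).
  have et : e = (fun i => tagged t i).
    by apply: funext => i; rewrite ffunE inordK // ltnS.
  have ve : valid k e by [].
  have : vanish (f t) k e by move: ve; rewrite et; case: (fP t).
  move=> /(_ P); rewrite PW => ftW; move/negP: FW; apply.
  by rewrite /F /polyfun rmorph_prod (bigD1 t) //= -/(polyfun _ _) ftW mul0r.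
have F0 : F != 0 by apply/prodf_neq0 => t _; case: (fP t).
exists (fun W => polyfun F W != 0); split.
- have [S SP] := zclosed_polyfun F; exists S => W; rewrite -SP.
  by split=> [/negP/negPn/eqP|-> /negP[]].
- exact: polyfun_nonzero_point.
move=> W FW; split; last exact: FP.
(* 0 is itself a product of degrees at least l. *)
apply: contraPneq (FP _ FW) => ->; apply.
exists s, omega, (fun i => 0); split=> //.
rewrite prod_perpE // (bigD1 (Ordinal (ltnW s1))) //=.
by rewrite (linear0 (@poly_of R l Q ip _)) mul0r linear0.
Qed.

Lemma zcodim_products s d (omega : 'I_s -> nat) :
  (0 < s)%N -> (forall i, (l <= omega i)%N) -> d = (\sum_i omega i)%N ->
  zcodim (nonzero_products (Q := Q) (ip := ip) (d := d) omega) (s.-1 * 'C(l.-1, 2)).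
Proof.
move=> s0 omega_ge dE.
exists (\sum_i (\dim {: V (omega i)}).-1).+1; last exact: dim_count.
split=> [|m Z]; last first.
  have cov := products_cover (Q := Q) (ip := ip) dE (fun i => dim_VQperp_gt0 (omega_ge i)).
  apply: zchain_le; case: cov => J [phi [pphi cov]]; exists J, phi; split=> // W [P _ WE].
  by apply: cov; exists P.
have full0 i : (fullv : {vspace V (omega i)}) != 0%VS.
  by rewrite -dimv_eq0 -lt0n dim_VQperp_gt0.
have [Z chZ _] := products_chain irrQ dE omega_ge s0 full0 erefl.
by exists Z.
Qed.

End Codimension.

Theorem lemma9 (R : realType) (l : nat) (Q : dhomog 3 R[i] l)
    (ip : forall k : nat, {dot (dhomog 3 R[i] k) for Num.conj})
    (s d : nat) (omega : 'I_s -> nat) :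
  (2 < l)%N ->
  irreducible_mpoly (mpoly_of_dhomog Q) ->
  (0 < s)%N ->
  (forall i, (l <= omega i)%N) ->
  d = (\sum_(i < s) omega i)%N ->
  ((2 <= s)%N ->
     ~ (forall W : VQperp Q ip d, W != 0 ->
          exists m : moduli Q ip omega, Phi d m = W) /\
     zgeneric (fun W : VQperp Q ip d =>
                 W != 0 /\ ~ product_of_degrees_ge W)) /\
  exists c : nat,
    zcodim (fun W : VQperp Q ip d =>
              exists m : moduli Q ip omega, Phi d m = W) c /\
    c%:R = (s%:R - 1) / 2%:R * (l%:R ^+ 2 - 3%:R * l%:R + 2%:R) :> rat.
Proof.
move=> l2 irrQ s0 omega_ge dE; split=> [s2|].
  have gen := generic_not_product ip l2 irrQ s2 omega_ge dE.
  split=> // onto; have [U [_ [W UW] /(_ W UW)[W0 nprod]]] := gen.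
  have /PhiP[P _ WE] := onto W W0.
  by apply: nprod; exists s, omega, P.
exists (s.-1 * 'C(l.-1, 2))%N; split.
  suff -> : (fun W : VQperp Q ip d => exists m : moduli Q ip omega, Phi d m = W) =
    nonzero_products omega by exact: zcodim_products.
  by apply: funext => W; apply: propext; apply: PhiP.
have g2 : ('C(l.-1, 2)%:R * 2 = (l%:R - 1) * (l%:R - 2) :> rat).
  have : ('C(l.-1, 2) * 2 = l.-1 * l.-2)%N by rewrite mulnC -mul_bin_diag bin1.
  move=> /(congr1 (fun n => n%:R : rat)); rewrite !natrM => ->.
  by case: l l2 {Q irrQ omega_ge} => [|[|k]] // _ /=; rewrite !mulrS; ring.
rewrite natrM -[s in RHS]prednK // mulrS [1 + _]addrC addrK.
have -> : 'C(l.-1, 2)%:R = (l%:R - 1) * (l%:R - 2) / 2 :> rat by rewrite -g2 mulfK.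
by field.
Qed.
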